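(* Let $\mu\in\mathcal M(\mathbb R^d)$ be a probability measure with contiguous support that is smooth at some $x\in D^*(\mu)$. Let $X_1,\dots,X_n$ be a random sample from $\mu$ (the first $n$ terms of an i.i.d. sequence with distribution $\mu$) defined on a probability space $(\Omega,\mathcal A,\mathsf P)$, and denote by $\widetilde{\mu_n}\equiv\widetilde{\mu_n}(\omega)\in\mathcal M(\mathbb R^d)$ the empirical measure of $X_1,\dots,X_n$. Then for any closed interval $A\subset(0,\alpha^*(\mu))$ $$\mathsf P\left(\left\{\omega\in\Omega:\lim_{n\to\infty}\sup_{\alpha\in A}\delta_H\left(D_\alpha(\widetilde{\mu_n}),D_\alpha(\mu)\right)=0\right\}\right)=1.$$ Further, let $\mu\in\mathcal M(\mathbb R^d)$ be any measure that is smooth with contiguous support. Then for any closed interval $A\subset(0,\alpha^*(\mu))$ and any sequence $\mu_n\in\mathcal M(\mathbb R^d)$ converging weakly to $\mu$, $$\lim_{n\to\infty}\sup_{\alpha\in A}\delta_H\left(D_\alpha(\mu_n),D_\alpha(\mu)\right)=0.$$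
   Context: $\mathcal M(\mathbb R^d)$ is the set of finite Borel measures on $\mathbb R^d$. $\mathcal H$ is the set of closed halfspaces $H_{x,u}=\{y\in\mathbb R^d:\langle x,u\rangle\le\langle y,u\rangle\}$, $x\in\mathbb R^d$, $u\in\mathbb S^{d-1}$; $\mathcal H(x)=\{H_{x,u}:u\in\mathbb S^{d-1}\}$. Halfspace depth: $D(x;\mu)=\inf_{H\in\mathcal H(x)}\mu(H)$; $D_\alpha(\mu)=\{x:D(x;\mu)\ge\alpha\}$ (compact for $\alpha>0$); $\alpha^*(\mu)=\sup\{\alpha\in\mathbb R:D_\alpha(\mu)\ne\emptyset\}$; the halfspace median set is $D^*(\mu)=D_{\alpha^*(\mu)}(\mu)$. $\mu$ is smooth if $\mu(\operatorname{bd}(H))=0$ for every $H\in\mathcal H$; $\mu$ is smooth at a point $x$ if $\mu(\operatorname{bd}(H))=0$ for every $H\in\mathcal H(x)$. $\mu$ has contiguous support if the support of $\mu$ cannot be separated by a slab of non-empty interior between two parallel hyperplanes with zero $\mu$-mass, i.e. there are no $u\in\mathbb S^{d-1}$ and $a<b$ with $\mu(\{y:a<\langle y,u\rangle<b\})=0$, $\mu(\{y:\langle y,u\rangle\le a\})>0$ and $\mu(\{y:\langle y,u\rangle\ge b\})>0$. Hausdorff distance of compact $K,L\subset\mathbb R^d$: $\delta_H(K,L)=\max\{\sup_{x\in K}\inf_{y\in L}|x-y|,\ \sup_{x\in L}\inf_{y\in K}|x-y|\}$ (with $\inf\emptyset=+\infty$, so the distance of an empty and a non-empty set is $+\infty$).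 A closed interval in $(0,\alpha^*(\mu))$ is of the form $[a,b]$ with $0<a\le b<\alpha^*(\mu)$. Weak convergence means $\int f\,d\mu_n\to\int f\,d\mu$ for all bounded continuous $f$. *)

(* Defs.v *)
From HB Require Import structures.
From mathcomp Require Import all_boot all_order all_algebra.
From mathcomp Require Import all_classical all_reals all_analysis.
Import Order.TTheory GRing.Theory Num.Theory.
Import numFieldNormedType.Exports.

Set Implicit Arguments.
Unset Strict Implicit.
Unset Printing Implicit Defensive.

Local Open Scope classical_set_scope.
Local Open Scope ring_scope.

(* The canonical norm `|x| on row vectors is the sup norm: it induces the usual
   topology of R^d, but lengths are measured with the Euclidean [enorm]. *)
Definition dot (R : realType) (d : nat) (x y : 'rV[R]_d) : R :=
  \sum_(i < d) x ord0 i * y ord0 i.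

Definition enorm (R : realType) (d : nat) (x : 'rV[R]_d) : R :=
  Num.sqrt (dot x x).

Definition unit_sphere (R : realType) (d : nat) : set 'rV[R]_d :=
  [set u | enorm u = 1].

Definition boundary (T : topologicalType) (A : set T) : set T :=
  closure A `\` interior A.

(* R^d with its Borel sigma-algebra; convertible to 'rV[R]_d. *)
Notation borel_rV R d := (g_sigma_algebraType (@open 'rV[R]_d)).

Section depth.
Variables (R : realType) (d : nat).
Implicit Types (mu : {measure set (borel_rV R d) -> \bar R}) (x u : 'rV[R]_d).

Definition halfspace x u : set 'rV[R]_d := [set y | dot x u <= dot y u].

Definition halfspaces_at x : set (set 'rV[R]_d) :=
  [set halfspace x u | u in @unit_sphere R d].

Definition halfspaces : set (set 'rV[R]_d) :=
  \bigcup_(x in [set: 'rV[R]_d]) halfspaces_at x.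

Definition depth x mu : \bar R :=
  ereal_inf [set mu H | H in halfspaces_at x].

Definition depth_region (alpha : R) mu : set 'rV[R]_d :=
  [set x | (alpha%:E <= depth x mu)%E].

(* For 0 < d and finite mu the set below contains 0 and is bounded by the total
   mass of mu, so that its real-valued supremum is the genuine one. *)
Definition max_depth mu : R :=
  sup [set alpha : R | depth_region alpha mu !=set0].

Definition median_set mu : set 'rV[R]_d := depth_region (max_depth mu) mu.

Definition smooth mu : Prop :=
  forall H, halfspaces H -> mu (boundary H) = 0%E.

Definition smooth_at x mu : Prop :=
  forall H, halfspaces_at x H -> mu (boundary H) = 0%E.

Definition contiguous_support mu : Prop :=
  ~ exists u : 'rV[R]_d, exists a b : R,
    [/\ unit_sphere u, a < b,
        mu [set y : 'rV[R]_d | a < dot y u < b] = 0%E,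
        (0 < mu [set y : 'rV[R]_d | (dot y u <= a)%R])%E &
        (0 < mu [set y : 'rV[R]_d | (b <= dot y u)%R])%E].

(* The supremum is taken in [0, +oo]: adjoining 0 gives excess set0 L = 0
   (instead of -oo), while excess K set0 = +oo for K nonempty. *)
Definition excess (K L : set 'rV[R]_d) : \bar R :=
  ereal_sup (0%E |`
    [set ereal_inf [set (enorm (x - y))%:E | y in L] | x in K]).

Definition hausdorff_dist (K L : set 'rV[R]_d) : \bar R :=
  Order.max (excess K L) (excess L K).

Definition sup_region_dist (A : set R) (nu mu : {measure set (borel_rV R d) -> \bar R}) :
    \bar R :=
  ereal_sup [set hausdorff_dist (depth_region alpha nu) (depth_region alpha mu)
            | alpha in A].

Definition weak_cvg (mun : nat -> {finite_measure set (borel_rV R d) -> \bar R})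
    (mu : {finite_measure set (borel_rV R d) -> \bar R}) : Prop :=
  forall f : 'rV[R]_d -> R, continuous f ->
    (exists M : R, forall x, `|f x| <= M) ->
    (\int[mun n]_(x in [set: borel_rV R d]) (f x)%:E)%E @[n --> \oo] -->
      (\int[mu]_(x in [set: borel_rV R d]) (f x)%:E)%E.

End depth.

Section sample.
Context (R : realType) (d : nat) (d' : measure_display) (Omega : measurableType d')
  (P : probability Omega R).

Definition mutually_independent (X : nat -> {RV P >-> borel_rV R d}) : Prop :=
  forall (J : seq nat) (B : nat -> set (borel_rV R d)),
    uniq J -> (forall i, measurable (B i)) ->
    P (\bigcap_(i in [set` J]) (X i @^-1` B i)) =
    (\prod_(i <- J) P (X i @^-1` B i))%E.

Definition iid_sample (mu : probability (borel_rV R d) R)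
    (X : nat -> {RV P >-> borel_rV R d}) : Prop :=
  mutually_independent X /\
  forall i (B : set (borel_rV R d)),
    measurable B -> distribution P (X i) B = mu B.

(* n^-1 * \sum_(i < n) dirac (X i w); for n = 0 this is the zero measure. *)
Definition empirical_measure (X : nat -> {RV P >-> borel_rV R d}) (n : nat)
    (w : Omega) : {measure set (borel_rV R d) -> \bar R} :=
  mscale ((n%:R : R)^-1)%:nng (msum (fun i => \d_(X i w)) n).

End sample.

(* Main.v *)
Require Import Defs.
From HB Require Import structures.
From mathcomp Require Import all_boot all_order all_algebra.
From mathcomp Require Import all_classical all_reals all_analysis.
From mathcomp Require Import measurable_realfun ring lra zify.
Import Order.TTheory GRing.Theory Num.Theory.
Import numFieldNormedType.Exports.

(** Both assertions come from one statement about weak limits: if measures nu_i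
    converge weakly to mu, if mu has contiguous support, and if mu is smooth at
    some point x0 of depth greater than b, then the depth regions of levels in
    [a, b] converge uniformly ([sup_region_dist_cvg]).  Weak convergence is used
    in portmanteau form, with a lower bound on the limits of open sets and an
    upper bound on the limit of the total mass.

    Weak convergence alone makes the depth upper semicontinuous jointly in the
    point and the measure ([depth_near_lt]); hence limits of deep points are
    deep.  For the Hausdorff distance a lower bound is needed as well.  It is
    obtained after the contraction x |-> (1 - s) x + s x0 with a small s > 0,
    which strictly raises the depth, even when only interiors of halfspaces are
    counted ([depth_lt_ohalfspace_contraction]).  This is where contiguity and
    smoothness at x0 enter, and they are what excludes a jump of the depth
    regions.  As masses of open halfspaces are lower semicontinuous, the strict
    inequality persists for nearby points, directions and measures, and
    compactness makes this uniform ([depth_contraction_near]).  The contraction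
    moves points of a bounded set by at most a prescribed epsilon, and it sends
    the region of level alpha of one measure into the region of level alpha of
    the other.

    For weakly converging sequences a Urysohn function between a compact set and
    an open set gives the portmanteau form ([weak_cvg_portmanteau]).  For
    empirical measures the strong law of large numbers, applied to the countably
    many finite unions of rational balls, gives it almost surely
    ([empirical_portmanteau_cvg]); the law is proved for indicators from second
    moments along the squares ([strong_law_indic]).

    The event itself has to be measurable, since the sample space need not be
    complete.  The sample of size n is viewed as a random matrix.  By upper
    semicontinuity the configurations whose depth region meets a given compact
    set form a closed set of matrices ([closed_hits]).  The event that the
    supremum of the distances is at most r is built from such closed sets
    ([measurable_sup_region_dist_le]): one half of the Hausdorff distance gives
    an intersection of them, the other half the complement of a union, which is
    countable because empirical depths only take the values k / n. *)

Set Implicit Arguments.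
Unset Strict Implicit.
Unset Printing Implicit Defensive.
Local Open Scope classical_set_scope.
Local Open Scope ring_scope.

(** * Rational balls as a countable base *)

Section rational_balls.
Variables (R : realType) (m n : nat).

Definition ratpt (q : 'M[rat]_(m, n)) : 'M[R]_(m, n) := map_mx ratr q.

Lemma rational_approx (x : 'M[R]_(m, n)) (e : R) : 0 < e ->
  exists q : 'M[rat]_(m, n), ball (ratpt q) e x.
Proof.
move=> e0.
have ex i j : {q : rat | `|ratr q - x i j| < e}.
  apply: cid; have /rat_in_itvoo[q] : x i j - e < x i j + e by lra.
  rewrite in_itv/= => /andP[q1 q2]; exists q.
  by rewrite ltr_norml; apply/andP; split; lra.
exists (\matrix_(i, j) sval (ex i j)); split=> // i j.
by rewrite !mxE /ball/=; exact: svalP (ex i j).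
Qed.

Definition rball (p : 'M[rat]_(m, n) * nat) : set 'M[R]_(m, n) :=
  ball (ratpt p.1) p.2.+1%:R^-1.

Definition rcball (p : 'M[rat]_(m, n) * nat) : set 'M[R]_(m, n) :=
  closed_ball (ratpt p.1) p.2.+1%:R^-1.

(** The closed ball is kept inside G so that finite unions of such balls lie
    between an open and a compact subset of G. *)
Lemma rball_basis (G : set 'M[R]_(m, n)) x : open G -> G x ->
  exists p, rball p x /\ rcball p `<=` G.
Proof.
move=> oG Gx; have : nbhs x G by exact: open_nbhs_nbhs.
move=> /nbhs_ballP[e /= e0 eG].
have e40 : 0 < e / 4 by rewrite divr_gt0.
have [k] := @ltr_add_invr R 0 (e / 4) e40; rewrite add0r => ke.
have k0 : 0 < k.+1%:R^-1 :> R by rewrite invr_gt0 ltr0n.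
have [q qx] := @rational_approx x k.+1%:R^-1 k0.
exists (q, k); split => //= y.
rewrite /rcball closed_ballE//= /closed_ball_/= => qy.
apply: eG; move: qx; rewrite mx_norm_ball /ball_/= => qx.
rewrite -[x - y](subrKA (ratpt q)).
apply: le_lt_trans (ler_normD _ _) _; rewrite distrC.
set u := `|_| in qx *; set v := `|_| in qy *; set w := _^-1 in ke qx qy.
by lra.
Qed.

End rational_balls.
Arguments ratpt R {m n} q.
Arguments rball R {m n} p.
Arguments rcball R {m n} p.

Section open_approximation.
Variables (R : realType) (d : nat).
Implicit Types (mu : {measure set (borel_rV R d) -> \bar R}).

Lemma open_measurable_rV (G : set 'rV[R]_d) : open G ->
  measurable (G : set (borel_rV R d)).
Proof. by move=> oG; exact: sub_sigma_algebra. Qed.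

Lemma closed_measurable_rV (C : set 'rV[R]_d) : closed C ->
  measurable (C : set (borel_rV R d)).
Proof.
move=> cC; rewrite -[C]setCK; apply: measurableC.
by apply: open_measurable_rV; rewrite openC.
Qed.

Definition rballs (s : seq ('rV[rat]_d * nat)) : set 'rV[R]_d :=
  \big[setU/set0]_(p <- s) rball R p.

Lemma rballs_open s : open (rballs s).
Proof.
apply: (big_ind open); [exact: open0|exact: openU|].
by move=> p _; exact: ball_open.
Qed.

Lemma rcball_compact (p : 'rV[rat]_d * nat) : compact (rcball R p).
Proof.
apply: bounded_closed_compact; last exact: closed_ball_closed.
exists (`|ratpt R p.1| + p.2.+1%:R^-1); split; first exact: num_real.
move=> M pM x; rewrite /rcball closed_ballE//= /closed_ball_/= distrC => xp.
apply: le_trans (ltW pM); rewrite -[x](subrK (ratpt R p.1)) addrC.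
by apply: le_trans (ler_normD _ _) _; rewrite lerD2l.
Qed.

(** Inner regularity of open sets through finite unions of rational balls: this
    is what lets a countable family of test sets control all open sets, and
    what supplies compact sets inside open halfspaces. *)
Lemma open_inner_approx mu (G : set 'rV[R]_d) (c : R) : open G ->
  (c%:E < mu G)%E ->
  exists s K, [/\ compact K, rballs s `<=` K, K `<=` G &
                  (c%:E < mu (rballs s))%E].
Proof.
move=> oG cG.
pose S k : seq ('rV[rat]_d * nat) :=
  [seq p <- pmap unpickle (iota 0 k) | `[< rcball R p `<=` G >]].
have Smono k l : (k <= l)%N -> rballs (S k) `<=` rballs (S l).
  move=> kl; rewrite /rballs -!bigcup_seq => x [p /= pk xp]; exists p => //=.
  move: pk; rewrite !mem_filter => /andP[-> /=].
  rewrite !mem_pmap => /mapP[i]; rewrite !mem_iota/= => ik pi.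
  by apply/mapP; exists i => //; rewrite mem_iota/= (leq_trans _ kl).
have SG : \bigcup_k rballs (S k) = G.
  rewrite eqEsubset; split => x.
    move=> [k _]; rewrite /rballs -bigcup_seq => -[p /=].
    rewrite mem_filter => /andP[/asboolP pG _] xp.
    by apply: pG; exact: subset_closed_ball.
  move=> Gx; have [p [xp pG]] := rball_basis oG Gx.
  exists (pickle p).+1 => //; rewrite /rballs -bigcup_seq; exists p => //=.
  rewrite mem_filter; apply/andP; split; first exact/asboolP.
  rewrite mem_pmap; apply/mapP; exists (pickle p); last by rewrite pickleK.
  by rewrite mem_iota/=.
have mS k : measurable (rballs (S k) : set (borel_rV R d)).
  by apply: open_measurable_rV; exact: rballs_open.
have /(_ mS) := @nondecreasing_cvg_mu _ _ _ mu (rballs \o S).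
rewrite /= SG => /(_ (open_measurable_rV oG)) /(_ _)/wrap[].
  by move=> k l kl; apply/subsetPset; exact: Smono.
move=> /(_ [set y | c%:E < y]%E)[].
  by apply: open_nbhs_nbhs; split => //; exact: open_ereal_gt_ereal.
move=> k _ /(_ k (leqnn k)) /= ck.
exists (S k), (\big[setU/set0]_(p <- S k) rcball R p); split => //.
- by apply: bigsetU_compact => p _; exact: rcball_compact.
- rewrite /rballs -!bigcup_seq => x [p /= pk xp].
  by exists p => //; exact: subset_closed_ball.
- rewrite -bigcup_seq => x [p /=]; rewrite mem_filter => /andP[/asboolP pG _].
  exact: pG.
Qed.

End open_approximation.

(** * Inner product and Euclidean norm *)

Section inner_product.
Variables (R : realType) (d : nat).
Implicit Types (x y z u : 'rV[R]_d) (a : R).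

Lemma dotDl x y z : dot (x + y) z = dot x z + dot y z.
Proof. by rewrite -big_split; apply: eq_bigr => i _; rewrite mxE mulrDl. Qed.

Lemma dotZl a x y : dot (a *: x) y = a * dot x y.
Proof. by rewrite mulr_sumr; apply: eq_bigr => i _; rewrite mxE mulrA. Qed.

Lemma dotC x y : dot x y = dot y x.
Proof. by apply: eq_bigr => i _; rewrite mulrC. Qed.

Lemma dotNr x y : dot x (- y) = - dot x y.
Proof. by rewrite -sumrN; apply: eq_bigr => i _; rewrite mxE mulrN. Qed.

Lemma dotNl x y : dot (- x) y = - dot x y.
Proof. by rewrite dotC dotNr dotC. Qed.

Lemma dot_ge0 x : 0 <= dot x x.
Proof. by apply: sumr_ge0 => i _; exact: sqr_ge0. Qed.

Lemma cvg_dot (I : Type) (F : set_system I) (f g : I -> 'rV[R]_d) x y :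
  Filter F -> f i @[i --> F] --> x -> g i @[i --> F] --> y ->
  dot (f i) (g i) @[i --> F] --> dot x y.
Proof.
move=> FF fx gy.
apply: (@cvg_big _ _ +%R 0 xpredT _ _ F _ (fun i t => f t ord0 i * g t ord0 i)
  (fun i => x ord0 i * y ord0 i)) => [|i _].
  by move=> p; apply: (@cvgD R R^o _ _ _ fst snd); [exact: cvg_fst|exact: cvg_snd].
have coord (h : I -> 'rV[R]_d) z : h j @[j --> F] --> z ->
    h j ord0 i @[j --> F] --> z ord0 i.
  by move=> hz; exact: (cvg_comp _ _ hz (@coord_continuous R 1 d ord0 i z)).
by apply: cvgM; exact: coord.
Qed.

Lemma enormZ a x : 0 <= a -> enorm (a *: x) = a * enorm x.
Proof.
move=> a0; rewrite /enorm dotZl dotC dotZl mulrA -expr2 sqrtrM ?sqr_ge0//.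
by rewrite sqrtr_sqr ger0_norm.
Qed.

Lemma enormN x : enorm (- x) = enorm x.
Proof. by rewrite /enorm dotNl dotNr opprK. Qed.

Lemma enorm_ge0 x : 0 <= enorm x.
Proof. exact: sqrtr_ge0. Qed.

Lemma enorm_continuous : continuous (@enorm R d).
Proof.
move=> x; apply: (@continuous_comp _ _ _ (fun x => dot x x) Num.sqrt).
  exact: (@cvg_dot _ _ id id x x (nbhs_filter x)).
exact: sqrt_continuous.
Qed.

Lemma enorm_sub_continuous x :
  continuous (fun y : 'rV[R]_d => enorm (x - y)).
Proof.
move=> y; have xy : x - z @[z --> y] --> x - y.
  exact: (@cvgB _ _ _ _ (nbhs_filter y) (cst x) id x y (cvg_cst x) cvg_id).
exact: cvg_comp _ _ xy (@enorm_continuous (x - y)).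
Qed.

Lemma normr_coord_le_enorm x i : `|x ord0 i| <= enorm x.
Proof.
rewrite -sqrtr_sqr ler_wsqrtr// /dot (bigD1 i)//= -expr2 lerDl.
by apply: sumr_ge0 => j _; exact: sqr_ge0.
Qed.

Lemma norm_le_enorm x : `|x| <= enorm x.
Proof.
rewrite [leLHS]/Num.Def.normr/= mx_normrE; apply/bigmax_leP; split; first exact: enorm_ge0.
by move=> [i j] _; rewrite (ord1 i); exact: normr_coord_le_enorm.
Qed.

Lemma normr_coord_le x i : `|x ord0 i| <= `|x|.
Proof.
rewrite [leRHS]/Num.Def.normr/= mx_normrE; apply/bigmax_geP; right => /=.
by exists (ord0, i).
Qed.

Lemma unit_sphere_compact : compact (@unit_sphere R d).
Proof.
apply: bounded_closed_compact.
  exists 1; split; first exact: num_real.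
  by move=> M M1 x /= ux; rewrite (le_trans (norm_le_enorm x))// ux ltW.
have -> : @unit_sphere R d = @enorm R d @^-1` [set 1] by [].
by apply: closed_comp; [move=> ? _; exact: enorm_continuous|exact: closed_eq].
Qed.

Lemma unit_sphereN u : unit_sphere (- u) = unit_sphere u.
Proof. by rewrite /unit_sphere/= enormN. Qed.

Lemma unit_sphere_dot u : unit_sphere u -> dot u u = 1.
Proof.
rewrite /unit_sphere/= /enorm => /(congr1 (fun r => r ^+ 2)).
by rewrite sqr_sqrtr ?dot_ge0// expr1n.
Qed.

End inner_product.

(** * Halfspaces and weak limits *)

Section weak_limits.
Variables (R : realType) (d : nat).
Local Notation measureRd := {measure set (borel_rV R d) -> \bar R}.
Implicit Types (mu : measureRd) (x y u : 'rV[R]_d).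

(** Weak convergence in portmanteau form, along an arbitrary filter.  The same
    notion serves for sequences of measures, for the constant family, for pairs
    (point, index) and for empirical measures whose atoms move. *)
Definition portmanteau_cvg (I : Type) (F : set_system I) (nu : I -> measureRd)
    mu : Prop :=
  (forall (G : set 'rV[R]_d), open G -> forall c : R, (c%:E < mu G)%E ->
    \forall i \near F, (c%:E < nu i G)%E) /\
  (forall c : R, (mu [set: 'rV[R]_d] < c%:E)%E ->
    \forall i \near F, (nu i [set: 'rV[R]_d] < c%:E)%E).

Lemma portmanteau_cvg_cst (I : Type) (F : set_system I) mu : Filter F ->
  portmanteau_cvg F (fun=> mu) mu.
Proof. by move=> FF; split=> [G _ c cG|c cG]; exact: nearW. Qed.

Lemma portmanteau_cvg_comp (I J : Type) (F : set_system I) (G : set_system J)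
    (h : J -> I) (nu : I -> measureRd) mu :
  h j @[j --> G] --> F -> portmanteau_cvg F nu mu ->
  portmanteau_cvg G (nu \o h) mu.
Proof.
move=> hF [opn tot]; split=> [U oU c cU|c cT].
  exact: (hF _ (opn U oU c cU)).
exact: (hF _ (tot c cT)).
Qed.

Definition ohalfspace x u : set 'rV[R]_d := [set y | dot x u < dot y u].

Lemma ohalfspace_open x u : open (ohalfspace x u).
Proof.
have -> : ohalfspace x u = (fun y => dot y u) @^-1` [set r | dot x u < r] by [].
apply: open_comp; last exact: open_gt.
by move=> y _; exact: (cvg_dot (nbhs_filter y) cvg_id (cvg_cst u)).
Qed.

Lemma halfspaceE x u : halfspace x u = ~` ohalfspace x (- u).
Proof.
apply/seteqP; split=> y; rewrite /halfspace /ohalfspace /= !dotNr ltrN2.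
  by move=> xy; apply/negP; rewrite -leNgt.
by move=> /negP; rewrite -leNgt.
Qed.

Lemma halfspace_closed x u : closed (halfspace x u).
Proof. by rewrite halfspaceE; exact/open_closedC/ohalfspace_open. Qed.

Lemma ohalfspace_measurable x u :
  measurable (ohalfspace x u : set (borel_rV R d)).
Proof. exact: (open_measurable_rV (@ohalfspace_open x u)). Qed.

Lemma halfspace_measurable x u :
  measurable (halfspace x u : set (borel_rV R d)).
Proof. exact: (closed_measurable_rV (@halfspace_closed x u)). Qed.

Lemma ohalfspace_sub x u : ohalfspace x u `<=` halfspace x u.
Proof. by move=> y; rewrite /ohalfspace /halfspace /=; exact: ltW. Qed.

(** A compact set that carries most of the mass of an open halfspace stays
    inside the halfspaces obtained by moving the point and the normal a little;
    its interior does not lose mass in the limit. *)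
Lemma ohalfspace_near_gt (I : Type) (F : set_system I) (nu : I -> measureRd) mu
    (y v : I -> 'rV[R]_d) x u (c : R) :
  Filter F -> portmanteau_cvg F nu mu ->
  y i @[i --> F] --> x -> v i @[i --> F] --> u ->
  (c%:E < mu (ohalfspace x u))%E ->
  \forall i \near F, (c%:E < nu i (ohalfspace (y i) (v i)))%E.
Proof.
move=> FF [opn _] yx vu cx.
have [s [K [cK sK KG cs]]] := open_inner_approx (@ohalfspace_open x u) cx.
have Kin : \forall i \near F, K `<=` ohalfspace (y i) (v i).
  have /compact_near_coveringP := cK.
  move=> /(_ I F (fun i z => dot (y i) (v i) < dot z (v i)) FF); apply => z Kz.
  have /cvgr_gt : dot p.1 (v p.2) - dot (y p.2) (v p.2)
      @[p --> filter_prod (nbhs z) F] --> dot z u - dot x u.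
    apply: cvgB; apply: cvg_dot.
    - exact: cvg_fst.
    - exact: (cvg_comp _ _ cvg_snd vu).
    - exact: (cvg_comp _ _ cvg_snd yx).
    - exact: (cvg_comp _ _ cvg_snd vu).
  move=> /(_ 0); rewrite subr_gt0 => /(_ (KG _ Kz)).
  by apply: filterS => p; rewrite subr_gt0.
apply: filterS2 Kin (opn _ (@rballs_open R d s) c cs) => i Ki ci.
apply: lt_le_trans ci _; apply: le_measure; rewrite ?inE.
- exact: (open_measurable_rV (@rballs_open R d s)).
- exact: ohalfspace_measurable.
- exact: subset_trans Ki.
Qed.

(** Upper semicontinuity comes from the previous lemma on the complementary open
    halfspace, because total masses converge. *)
Lemma halfspace_near_lt (I : Type) (F : set_system I) (nu : I -> measureRd) mu
    (y v : I -> 'rV[R]_d) x u (c : R) :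
  Filter F -> (mu [set: 'rV[R]_d] < +oo)%E -> portmanteau_cvg F nu mu ->
  y i @[i --> F] --> x -> v i @[i --> F] --> u ->
  (mu (halfspace x u) < c%:E)%E ->
  \forall i \near F, (nu i (halfspace (y i) (v i)) < c%:E)%E.
Proof.
move=> FF muT cvg yx vu xc.
have split_half (m : measureRd) z w :
    (m [set: 'rV[R]_d] = m (halfspace z w) + m (ohalfspace z (- w)))%E.
  rewrite -measureU ?halfspaceE ?setvU ?setICl//.
  - by rewrite -halfspaceE; exact: halfspace_measurable.
  - exact: ohalfspace_measurable.
have fin (A : set (borel_rV R d)) : measurable A -> mu A \is a fin_num.
  move=> mA; rewrite ge0_fin_numE//; apply: le_lt_trans muT.
  by apply: le_measure; rewrite ?inE.
have [h hE] : exists h : R, mu (halfspace x u) = h%:E.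
  by exists (fine (mu (halfspace x u))); rewrite fineK// fin//; exact: halfspace_measurable.
have [g gE] : exists g : R, mu (ohalfspace x (- u)) = g%:E.
  by exists (fine (mu (ohalfspace x (- u)))); rewrite fineK// fin//; exact: ohalfspace_measurable.
move: xc; rewrite hE lte_fin => hc.
(* Half of the gap c - h is left for the convergence of the total mass. *)
pose e := g - (c - h) / 2.
have vNu : - v i @[i --> F] --> - u by exact: cvgN.
have eo : (e%:E < mu (ohalfspace x (- u)))%E by rewrite gE lte_fin /e; lra.
have N1 := ohalfspace_near_gt FF cvg yx vNu eo.
have te : (mu [set: 'rV[R]_d] < (c + e)%:E)%E.
  by rewrite (split_half mu x u) hE gE -EFinD lte_fin /e; lra.
apply: filterS2 N1 (cvg.2 _ te) => i.
rewrite (split_half (nu i) (y i) (v i)).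
move: (nu i (halfspace _ _)) (nu i (ohalfspace _ _)) => [p||] [q||]//=.
- by rewrite -EFinD !lte_fin; lra.
- by move=> _ _; exact: ltNyr.
- by move=> _ _; exact: ltNyr.
Qed.

End weak_limits.

(** * Semicontinuity of the depth *)

Section depth_semicontinuity.
Variables (R : realType) (d : nat).
Local Notation measureRd := {measure set (borel_rV R d) -> \bar R}.
Implicit Types (mu : measureRd) (x y u : 'rV[R]_d).

Lemma depth_le mu x u : unit_sphere u -> (depth x mu <= mu (halfspace x u))%E.
Proof. by move=> su; apply: ereal_inf_lbound; exists (halfspace x u) => //; exists u. Qed.

Lemma depth_ge mu x (c : \bar R) :
  (forall u, unit_sphere u -> (c <= mu (halfspace x u))%E) ->
  (c <= depth x mu)%E.
Proof. by move=> cH; apply/ereal_infP => _ [_ [u su <-] <-]; exact: cH. Qed.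

Lemma depth_lt mu x (c : \bar R) : (depth x mu < c)%E ->
  exists2 u, unit_sphere u & (mu (halfspace x u) < c)%E.
Proof. by move=> /ereal_inf_lt[_ [_ [u su <-] <-] uc]; exists u. Qed.

(** A direction that is nearly optimal for mu at x bounds the depth of the moving
    points with respect to the moving measures. *)
Lemma depth_near_lt (I : Type) (F : set_system I) (nu : I -> measureRd) mu
    (y : I -> 'rV[R]_d) x (c : R) :
  Filter F -> (mu [set: 'rV[R]_d] < +oo)%E -> portmanteau_cvg F nu mu ->
  y i @[i --> F] --> x -> (depth x mu < c%:E)%E ->
  \forall i \near F, (depth (y i) (nu i) < c%:E)%E.
Proof.
move=> FF muT cvg yx /depth_lt[u su uc].
apply: filterS (halfspace_near_lt FF muT cvg yx (cvg_cst u) uc) => i.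
by apply: le_lt_trans; exact: depth_le.
Qed.

(** A ball of nearly full mass misses the halfspace orthogonal to the largest
    coordinate at any point outside the ball, so such points are shallow. *)
Lemma depth_region_near_bounded (I : Type) (F : set_system I)
    (nu : I -> measureRd) mu (a : R) : 0 < a ->
  Filter F -> (mu [set: 'rV[R]_d] < +oo)%E -> portmanteau_cvg F nu mu ->
  exists M : R, \forall i \near F, forall x, depth_region a (nu i) x -> `|x| <= M.
Proof.
move=> a0 FF muT [opn tot].
have [m mE] : exists m : R, mu [set: 'rV[R]_d] = m%:E.
  by exists (fine (mu [set: 'rV[R]_d])); rewrite fineK// ge0_fin_numE.
pose B (k : nat) : set 'rV[R]_d := [set y | `|y| < k%:R].
have oB k : open (B k).
  apply: (@open_comp _ _ (fun y : 'rV[R]_d => `|y|) [set r | r < k%:R]).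
    by move=> y _; exact: norm_continuous.
  exact: open_lt.
have BT : \bigcup_k B k = [set: 'rV[R]_d].
  apply/seteqP; split => // y _; exists (Num.truncn `|y|).+1 => //.
  by rewrite /B /= truncnS_gt.
have [k mk] : exists k, ((m - a / 2)%:E < mu (B k))%E.
  have := @nondecreasing_cvg_mu _ _ _ mu B
    (fun k => open_measurable_rV (oB k)).
  rewrite /= BT => /(_ (open_measurable_rV openT)) /(_ _)/wrap[].
    move=> k l kl; apply/subsetPset => y; rewrite /B/= => /lt_le_trans; apply.
    by rewrite ler_nat.
  move=> /(_ [set y | (m - a / 2)%:E < y]%E)[].
    apply: open_nbhs_nbhs; split => /=; first exact: open_ereal_gt_ereal.
    by rewrite mE lte_fin; lra.
  by move=> k _ /(_ k (leqnn k)) /= ck; exists k.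
have te : (mu [set: 'rV[R]_d] < (m + a / 2)%:E)%E by rewrite mE lte_fin; lra.
exists k%:R; apply: filterS2 (opn _ (oB k) _ mk) (tot _ te) => i Bi Ti x.
rewrite /depth_region/= => ax; rewrite leNgt; apply/negP => kx.
have [[i0 j] xj] : exists ij, `|x| = `|x ij.1 ij.2|.
  apply: mx_norm_neq0; rewrite -[mx_norm x]/(`|x|) gt_eqF//.
  by apply: le_lt_trans kx; rewrite ler0n.
move: xj; rewrite (ord1 i0) /= => xj.
pose u : 'rV[R]_d := Num.sg (x ord0 j) *: delta_mx ord0 j.
have dotu y : dot y u = Num.sg (x ord0 j) * y ord0 j.
  rewrite dotC dotZl; congr (_ * _); rewrite /dot (bigD1 j)//= mxE !eqxx mul1r.
  by rewrite big1 ?addr0// => l lj; rewrite mxE (negPf lj) mul0r.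
have x0 : x ord0 j != 0.
  rewrite -normr_gt0 -xj; apply: le_lt_trans kx; exact: ler0n.
have su : unit_sphere u.
  rewrite /unit_sphere/= /enorm dotu !mxE !eqxx mulr1 -expr2 sqr_sg x0.
  by rewrite sqrtr1.
have HB : halfspace x u `&` B k = set0.
  rewrite -subset0 => y; rewrite /halfspace /B/= !dotu => -[].
  rewrite -normrEsg -xj => xy yk.
  have : `|x| <= `|y|.
    apply: le_trans xy _; apply: le_trans (normr_coord_le y j).
    by apply: le_trans (ler_norm _) _; rewrite normrM normr_sg x0 mul1r.
  by apply/negP; rewrite -ltNge; exact: lt_trans kx.
have : (nu i (halfspace x u) + nu i (B k) <= nu i [set: 'rV[R]_d])%E.
  rewrite -measureU//; [|exact: halfspace_measurable|exact: (open_measurable_rV (oB k))].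
  apply: le_measure; rewrite ?inE//; apply: measurableU.
    exact: halfspace_measurable.
  exact: (open_measurable_rV (oB k)).
have := le_trans ax (depth_le (nu i) x su).
move: Bi Ti; move: (nu i _) (nu i _) (nu i _) => [p||] [q||] [r||]//=.
by rewrite -EFinD !lee_fin !lte_fin; lra.
Qed.

End depth_semicontinuity.

(** * Strict growth of the depth towards a smooth point *)

Section contraction_to_a_smooth_point.
Variables (R : realType) (d : nat).
Local Notation measureRd := {measure set (borel_rV R d) -> \bar R}.
Implicit Types (mu : measureRd) (x y u : 'rV[R]_d).

(** The bounding hyperplane lies in the topological boundary of the halfspace,
    so smoothness makes it null. *)
Lemma smooth_at_ohalfspace mu x u : smooth_at x mu -> unit_sphere u ->
  mu (ohalfspace x u) = mu (halfspace x u).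
Proof.
move=> smx su; pose L : set 'rV[R]_d := [set y | dot y u = dot x u].
have LE : L = halfspace x u `\` ohalfspace x u.
  apply/seteqP; split=> y; rewrite /L /halfspace /ohalfspace /=.
    by move=> ->; rewrite lexx ltxx.
  by move=> [xy /negP]; rewrite -leNgt => yx; apply/le_anti/andP.
have mL : measurable (L : set (borel_rV R d)).
  rewrite LE; apply: measurableD; [exact: halfspace_measurable|].
  exact: ohalfspace_measurable.
have Lbd : L `<=` boundary (halfspace x u).
  move=> y Ly; split.
    by apply: subset_closure; rewrite /halfspace/= Ly.
  (* Moving y slightly against u leaves the halfspace. *)
  move=> /nbhs_ballP[e /= e0 eH].
  have su0 : 0 < `|u| + 1 by rewrite ltr_wpDl.
  pose t := e / 2 / (`|u| + 1).
  have t0 : 0 < t by rewrite !divr_gt0.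
  have tE : t * `|u| + t = e / 2.
    by rewrite -[X in _ + X]mulr1 -mulrDr divfK// gt_eqF.
  have : ball y e (y - t *: u).
    rewrite mx_norm_ball /ball_/= opprD addNKr opprK normrZ gtr0_norm//.
    by lra.
  move=> /eH; rewrite /halfspace/= dotDl dotNl dotZl unit_sphere_dot// mulr1.
  by rewrite Ly; apply/negP; rewrite -ltNge gtrBl.
have bd0 : mu (boundary (halfspace x u)) = 0%E.
  by apply: smx; exists u.
have L0 : mu L = 0%E.
  apply: (@subset_measure0 _ (borel_rV R d) _ mu L _ mL _ Lbd bd0).
  apply: measurableD; first exact: (closed_measurable_rV (@closed_closure _ _)).
  exact: (open_measurable_rV (@open_interior _ _)).
have HE : halfspace x u = ohalfspace x u `|` L.
  by rewrite LE setDUK//; exact: ohalfspace_sub.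
rewrite HE measureU//; [|exact: ohalfspace_measurable|].
  by rewrite [X in (_ + X)%E](_ : _ = 0%E)// adde0.
by rewrite LE -subset0 => y [xy [_ /(_ xy)]].
Qed.

(** The depth strictly improves along the segment from x to the smooth point
    x0.  A halfspace at p whose interior misses x0 has x in its interior, and
    if that interior were no heavier than a halfspace at x, the open slab
    between p and x would be null although both of its sides have mass. *)
Lemma depth_lt_ohalfspace_contraction mu x0 x u (a b s : R) :
  (mu [set: 'rV[R]_d] < +oo)%E -> contiguous_support mu -> smooth_at x0 mu ->
  0 < a -> 0 < b -> 0 < s -> s <= 1 ->
  (b%:E < depth x0 mu)%E -> (a%:E <= depth x mu)%E -> unit_sphere u ->
  (Order.min (depth x mu) b%:E < mu (ohalfspace ((1 - s) *: x + s *: x0) u))%E.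
Proof.
move=> muT contig smx0 a0 b0 s0 s1 bx0 ax su.
set p := _ + _.
have pE : dot p u = (1 - s) * dot x u + s * dot x0 u by rewrite dotDl !dotZl.
have mono (A B : set (borel_rV R d)) : measurable A -> measurable B ->
    A `<=` B -> (mu A <= mu B)%E.
  by move=> mA mB AB; apply: le_measure; rewrite ?inE.
have [px0|x0p] := leP (dot p u) (dot x0 u).
  rewrite gt_min; apply/orP; right.
  apply: lt_le_trans bx0 (le_trans (depth_le mu x0 su) _).
  rewrite -smooth_at_ohalfspace//; apply: mono => [||y].
  - exact: ohalfspace_measurable.
  - exact: ohalfspace_measurable.
  - by rewrite /ohalfspace/=; exact: le_lt_trans.
have xx0 : dot x0 u < dot x u.
  rewrite -subr_gt0 ltNge; apply/negP => h.
  have := ler_wpM2l (_ : 0 <= 1 - s) h; rewrite subr_ge0 => /(_ s1).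
  by rewrite pE in x0p; lra.
have px : dot p u < dot x u.
  have : 0 < s * (dot x u - dot x0 u) by rewrite mulr_gt0// subr_gt0.
  by rewrite pE; lra.
apply: contrapT => /negP; rewrite -leNgt le_min => /andP[small _].
apply: contig; exists u, (dot p u), (dot x u).
set S := [set y | _ < _ < _].
have HS : ohalfspace p u = halfspace x u `|` S.
  apply/seteqP; split=> y; rewrite /ohalfspace /halfspace /S/=.
    by move=> py; have [xy|yx] := leP (dot x u) (dot y u); [left|right; rewrite py].
  by move=> [xy|/andP[]//]; exact: lt_le_trans px xy.
have mS : measurable (S : set (borel_rV R d)).
  have -> : S = ohalfspace p u `\` halfspace x u.
    rewrite HS setDUl setDv set0U; apply/esym/setDidPl; rewrite -subset0 => y.
    by rewrite /S /halfspace/= => -[/andP[_ yx]]; rewrite leNgt yx.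
  apply: measurableD; [exact: ohalfspace_measurable|exact: halfspace_measurable].
have Hfin : mu (halfspace x u) \is a fin_num.
  rewrite ge0_fin_numE//; apply: le_lt_trans muT; apply: mono => //.
  exact: halfspace_measurable.
have a0H : (0 < mu (halfspace x u))%E.
  by apply: lt_le_trans (le_trans ax (depth_le mu x su)); rewrite lte_fin.
split => //.
- have : (mu (halfspace x u) + mu S <= mu (halfspace x u))%E.
    rewrite -measureU//; [|exact: halfspace_measurable|].
      by rewrite -HS; apply: le_trans small (depth_le mu x su).
    rewrite -subset0 => y; rewrite /halfspace /S/= => -[+ /andP[_]].
    by move=> xy yx; move: (le_lt_trans xy yx); rewrite ltxx.
  move=> h; apply/eqP; rewrite eq_le measure_ge0 andbT.
  by rewrite -(leeD2lE _ _ Hfin) adde0.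
- have -> : [set y | dot y u <= dot p u] = halfspace p (- u).
    by apply/seteqP; split=> y; rewrite /halfspace/= !dotNr lerN2.
  apply: (@lt_le_trans _ _ (mu (halfspace x0 (- u)))).
    rewrite (lt_le_trans _ (depth_le mu x0 _)) ?unit_sphereN//.
    by apply: lt_trans bx0; rewrite lte_fin.
  apply: mono; [exact: halfspace_measurable|exact: halfspace_measurable|].
  move=> y; rewrite /halfspace/= !dotNr !lerN2 => /le_trans; apply; exact: ltW.
Qed.

End contraction_to_a_smooth_point.

(** * Uniform convergence of depth regions *)

Section uniform_convergence.
Variables (R : realType) (d : nat).
Local Notation measureRd := {measure set (borel_rV R d) -> \bar R}.
Implicit Types (mu : measureRd) (x y u : 'rV[R]_d).

(** Both inclusions of the Hausdorff convergence are instances of this lemma,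
    with (mu, nu_i) and with (nu_i, mu) in the role of the two families.  Near
    each point and each direction the strict inequality of
    [depth_lt_ohalfspace_contraction] survives a perturbation; compactness of
    the sphere, then of C, makes one neighbourhood serve all of them. *)
Lemma depth_contraction_near (I : Type) (F : set_system I)
    (nu rho : I -> measureRd) mu x0 (a b s : R) (C : set 'rV[R]_d) :
  Filter F -> (mu [set: 'rV[R]_d] < +oo)%E ->
  portmanteau_cvg F nu mu -> portmanteau_cvg F rho mu ->
  contiguous_support mu -> smooth_at x0 mu -> (b%:E < depth x0 mu)%E ->
  0 < a -> 0 < b -> 0 < s -> s <= 1 -> compact C ->
  \forall i \near F, forall x, C x -> (a%:E <= depth x (nu i))%E ->
    (Order.min (depth x (nu i)) b%:E <=
     depth ((1 - s) *: x + s *: x0) (rho i))%E.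
Proof.
move=> FF muT cnu crho contig smx0 bx0 a0 b0 s0 s1 cC.
pose p x := (1 - s) *: x + s *: x0.
have /compact_near_coveringP := cC.
move=> /(_ I F (fun i x => (a%:E <= depth x (nu i))%E ->
  (Order.min (depth x (nu i)) b%:E <= depth (p x) (rho i))%E) FF).
apply => x Cx.
pose G := filter_prod (nbhs x) F.
have cnuG : portmanteau_cvg G (nu \o snd) mu.
  exact: portmanteau_cvg_comp cvg_snd cnu.
have crhoG : portmanteau_cvg G (rho \o snd) mu.
  exact: portmanteau_cvg_comp cvg_snd crho.
have [xa|ax] := ltP (depth x mu) a%:E.
  apply: filterS (depth_near_lt _ muT cnuG cvg_fst xa) => -[y i]/= ya.
  by rewrite leNgt ya.
have pcvg : p y.1 @[y --> G] --> p x.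
  apply: cvgD; last exact: cvg_cst.
  by apply: cvgZr; exact: cvg_fst.
suff : \forall q \near G, @unit_sphere R d `<=` (fun u =>
    (Order.min (depth q.1 (nu q.2)) b%:E <= rho q.2 (halfspace (p q.1) u))%E).
  by apply: filterS => -[y i]/= yi _; apply: depth_ge => u su; exact: yi.
have /compact_near_coveringP := @unit_sphere_compact R d.
move=> /(_ _ G (fun q u => (Order.min (depth q.1 (nu q.2)) b%:E <=
  rho q.2 (halfspace (p q.1) u))%E) _); apply => u su.
have := depth_lt_ohalfspace_contraction muT contig smx0 a0 b0 s0 s1 bx0 ax su.
rewrite -/(p x) => lt_u.
have [c mc cu] : exists2 c : R, (Order.min (depth x mu) b%:E < c%:E)%E &
    (c%:E < mu (ohalfspace (p x) u))%E.
  have [m mE] : exists m : R, Order.min (depth x mu) b%:E = m%:E.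
    exists (fine (Order.min (depth x mu) b%:E)); rewrite fineK// fin_numE.
    rewrite gt_eqF/=; last by rewrite lt_min ltNyr andbT (lt_le_trans _ ax)// ltNyr.
    by rewrite lt_eqF// gt_min ltry orbT.
  have [g gE] : exists g : R, mu (ohalfspace (p x) u) = g%:E.
    exists (fine (mu (ohalfspace (p x) u))); rewrite fineK// ge0_fin_numE//.
    apply: le_lt_trans muT; apply: le_measure; rewrite ?inE//.
    exact: ohalfspace_measurable.
  by move: lt_u; rewrite mE gE lte_fin => mg; exists ((m + g) / 2); rewrite lte_fin; lra.
pose H := filter_prod (nbhs u) G.
have crhoH : portmanteau_cvg H (rho \o snd \o snd) mu.
  exact: portmanteau_cvg_comp cvg_snd crhoG.
have cnuH : portmanteau_cvg H (nu \o snd \o snd) mu.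
  exact: portmanteau_cvg_comp cvg_snd cnuG.
have pH : p q.2.1 @[q --> H] --> p x by exact: cvg_comp cvg_snd pcvg.
have xH : q.2.1 @[q --> H] --> x by exact: cvg_comp cvg_snd cvg_fst.
have low : \forall q \near H,
    (Order.min (depth q.2.1 (nu q.2.2)) b%:E < c%:E)%E.
  move: mc; rewrite gt_min => /orP[xc|bc].
    apply: filterS (depth_near_lt _ muT cnuH xH xc) => q /= qc.
    by rewrite gt_min qc.
  by apply: nearW => q; rewrite gt_min bc orbT.
apply: filterS2 low (ohalfspace_near_gt _ crhoH pH cvg_fst cu) => -[v [y i]]/=.
move=> /ltW yc /ltW cv; apply: le_trans yc (le_trans cv _).
apply: le_measure; rewrite ?inE; [exact: ohalfspace_measurable|
  exact: halfspace_measurable|exact: ohalfspace_sub].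
Qed.

Definition within_dist (r : R) (K L : set 'rV[R]_d) : Prop :=
  forall x, K x -> exists2 y, L y & enorm (x - y) <= r.

Lemma excess_le (r : R) (K L : set 'rV[R]_d) : 0 <= r -> within_dist r K L ->
  (excess K L <= r%:E)%E.
Proof.
move=> r0 KL; apply/ereal_supP => _ [->|[x Kx <-]]; first by rewrite lee_fin.
have [y Ly xy] := KL x Kx.
by apply: le_trans (_ : (enorm (x - y))%:E <= _)%E; [apply: ereal_inf_lbound; exists y|rewrite lee_fin].
Qed.

Lemma sup_region_dist_le (nu mu : measureRd) (a b r : R) : 0 <= r ->
  (forall alpha, a <= alpha <= b ->
    within_dist r (depth_region alpha nu) (depth_region alpha mu) /\
    within_dist r (depth_region alpha mu) (depth_region alpha nu)) ->
  (sup_region_dist `[a, b] nu mu <= r%:E)%E.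
Proof.
move=> r0 W; apply/ereal_supP => _ [alpha /= + <-].
rewrite in_itv/= => /W[W1 W2].
by rewrite /hausdorff_dist ge_max !excess_le.
Qed.

Lemma sup_region_dist_ge0 (nu mu : measureRd) (a b : R) : a <= b ->
  (0 <= sup_region_dist `[a, b] nu mu)%E.
Proof.
move=> ab; apply: le_trans (_ : hausdorff_dist (depth_region a nu)
   (depth_region a mu) <= _)%E.
  by rewrite /hausdorff_dist le_max; apply/orP; left; apply: ereal_sup_ubound; left.
by apply: ereal_sup_ubound; exists a => //=; rewrite in_itv/= lexx.
Qed.

Lemma nonneg_ecvg0P (I : Type) (F : set_system I) (f : I -> \bar R) :
  Filter F -> (forall i, (0 <= f i)%E) ->
  f i @[i --> F] --> 0%E <->
  (forall e : R, 0 < e -> \forall i \near F, (f i <= e%:E)%E).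
Proof.
move=> FF f0; split=> [f0cvg e e0|small].
  have nb : nbhs 0%E [set y | y < e%:E]%E.
    by apply: open_nbhs_nbhs; split; [exact: open_ereal_lt_ereal|rewrite /= lte_fin].
  have lt_e : \forall i \near F, (f i < e%:E)%E by exact: (f0cvg _ nb).
  by apply: filterS lt_e => i; exact: ltW.
apply/fine_cvgP; split.
  apply: filterS (small 1 ltr01) => i i1.
  by rewrite ge0_fin_numE// (le_lt_trans i1)// ltry.
apply/cvgrPdist_le => e e0; apply: filterS (small e e0) => i /= ie.
rewrite sub0r normrN ger0_norm ?fine_ge0// -lee_fin fineK//.
by rewrite ge0_fin_numE// (le_lt_trans ie)// ltry.
Qed.

(** For small s the contraction towards x0 moves the points of a compact set that
    contains all regions involved by at most e, and it maps the regions of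
    either measure into those of the other. *)
Lemma sup_region_dist_cvg (I : Type) (F : set_system I)
    (nu : I -> measureRd) mu x0 (a b : R) :
  Filter F -> (mu [set: 'rV[R]_d] < +oo)%E -> portmanteau_cvg F nu mu ->
  contiguous_support mu -> smooth_at x0 mu -> (b%:E < depth x0 mu)%E ->
  0 < a -> a <= b ->
  sup_region_dist `[a, b] (nu i) mu @[i --> F] --> 0%E.
Proof.
move=> FF muT cnu contig smx0 bx0 a0 ab.
have b0 : 0 < b by exact: lt_le_trans ab.
apply/nonneg_ecvg0P => [i|e e0]; first exact: sup_region_dist_ge0.
have cmu := portmanteau_cvg_cst mu FF.
have [M NM] := depth_region_near_bounded a0 FF muT cnu.
have [M' NM'] := depth_region_near_bounded a0 FF muT cmu.
pose C : set 'rV[R]_d := [set x | `|x| <= Num.max M M'].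
have cC : compact C.
  apply: bounded_closed_compact.
    exists (Num.max M M'); split; first exact: num_real.
    by move=> r Mr x /= /le_trans; apply; exact: ltW.
  apply: (@closed_comp _ _ (fun y : 'rV[R]_d => `|y|) [set r | r <= _]).
    by move=> y _; exact: norm_continuous.
  exact: closed_le.
have [D Dpos CD] : exists2 D : R, 0 < D & forall x, C x -> enorm (x - x0) <= D.
  have : compact [set enorm (x0 - x) | x in C].
    apply: continuous_compact cC; apply: continuous_subspaceT.
    exact: enorm_sub_continuous.
  move=> /compact_bounded[D [_ DC]].
  exists (Num.max 1 (D + 1)); first by rewrite lt_max ltr01.
  move=> x Cx; rewrite -enormN opprB -[enorm _]ger0_norm ?enorm_ge0//.
  apply: DC; last by exists x.
  by rewrite lt_max ltrDl ltr01 orbT.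
pose s := Num.min 1 (e / D).
have s0 : 0 < s by rewrite lt_min ltr01 divr_gt0.
have s1 : s <= 1 by rewrite ge_min lexx.
have close x : C x -> enorm (x - ((1 - s) *: x + s *: x0)) <= e.
  move=> Cx; have -> : x - ((1 - s) *: x + s *: x0) = s *: (x - x0).
    by rewrite scalerBl scale1r scalerBr opprD opprB addrA addrCA subrr addr0.
  rewrite enormZ ?(ltW s0)//; apply: le_trans (ler_wpM2l (ltW s0) (CD x Cx)) _.
  by rewrite -ler_pdivlMr// ge_min lexx orbT.
have N1 := depth_contraction_near FF muT cnu cmu contig smx0 bx0 a0 b0 s0 s1 cC.
have N2 := depth_contraction_near FF muT cmu cnu contig smx0 bx0 a0 b0 s0 s1 cC.
have NC : \forall i \near F, (forall x, depth_region a (nu i) x -> `|x| <= M) /\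
    (forall x, depth_region a mu x -> `|x| <= M') by exact: filterI.
apply: (filterS3 _ _ NC N1 N2) => i [iM iM'] i1 i2.
apply: sup_region_dist_le; first exact: ltW.
move=> alpha /andP[aal alb].
have sub (m : measureRd) x : depth_region alpha m x ->
    depth_region a m x /\ (alpha%:E <= Order.min (depth x m) b%:E)%E.
  rewrite /depth_region/= => h; split.
    by apply: le_trans h; rewrite lee_fin.
  by rewrite le_min h lee_fin.
split=> x /sub[xa xm]; exists ((1 - s) *: x + s *: x0).
- by apply: le_trans xm (i1 x _ xa); rewrite /C/= le_max iM.
- by apply: close; rewrite /C/= le_max iM.
- by apply: le_trans xm (i2 x _ xa); rewrite /C/= le_max iM' ?orbT.
- by apply: close; rewrite /C/= le_max iM' ?orbT.
Qed.

End uniform_convergence.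

(** * From weak convergence to the portmanteau form *)

Section weak_convergence.
Variables (R : realType) (d : nat).
Local Notation measureRd := {measure set (borel_rV R d) -> \bar R}.

Lemma continuous_measurable_rV (f : 'rV[R]_d -> R) : continuous f ->
  measurable_fun [set: borel_rV R d] f.
Proof.
move=> cf; apply: (measurability _ (RGenOInfty.measurableE R)).
move=> /= _ [_ [a ->]] <-; rewrite setTI; apply: open_measurable_rV.
have -> : f @^-1` `]a, +oo[ = f @^-1` [set r | a < r].
  by apply/seteqP; split=> x; rewrite /= in_itv/= andbT.
by apply: open_comp; [move=> ? _; exact: cf|exact: open_gt].
Qed.

(** A Urysohn function lies between the indicators of a compact set K, which
    carries almost all the mass of G, and of G itself. *)
Lemma weak_cvg_portmanteau
    (mun : nat -> {finite_measure set (borel_rV R d) -> \bar R})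
    (mu : {finite_measure set (borel_rV R d) -> \bar R}) :
  weak_cvg mun mu -> portmanteau_cvg \oo (fun n => mun n : measureRd) mu.
Proof.
move=> w; split=> [G oG c cG|c cT].
- have [s [K [cK sK KG cs]]] := open_inner_approx oG cG.
  have clK : closed K by apply: compact_closed => //; exact: norm_hausdorff.
  pose f : 'rV[R]_d -> R := Urysohn (~` G) K.
  have sep : uniform_separator (~` G) K.
    apply: normal_uniform_separator => //.
    - exact: (@pseudometric_normal R).
    - exact: open_closedC.
    - by rewrite -subset0 => x [/= nG /KG].
  have cf : continuous f by exact: Urysohn_continuous.
  have f01 x : 0 <= f x <= 1.
    have : (range f) (f x) by exists x.
    by move/(@Urysohn_range _ R (~` G) K); rewrite /= in_itv.
  have fG x : ~ G x -> f x = 0.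
    by move=> nGx; apply: (Urysohn_sub0 sep); exists x.
  have fK x : K x -> f x = 1.
    by move=> Kx; apply: (Urysohn_sub1 sep); exists x.
  have mf : measurable_fun [set: borel_rV R d] (fun x => (f x)%:E : \bar R).
    by apply/measurable_EFinP; exact: continuous_measurable_rV.
  have mind (A : set (borel_rV R d)) : measurable A ->
      measurable_fun [set: borel_rV R d] (fun x => (\1_A x)%:E : \bar R).
    by move=> mA; apply/measurable_EFinP; exact: measurable_indic.
  have mK := closed_measurable_rV clK.
  have mG := open_measurable_rV oG.
  have lo : (c%:E < \int[mu]_(x in [set: borel_rV R d]) (f x)%:E)%E.
    apply: (@lt_le_trans _ _ (mu K)).
      apply: lt_le_trans cs _; apply: le_measure; rewrite ?inE//.
      exact: (open_measurable_rV (@rballs_open R d s)).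
    rewrite -[X in mu X]setIT -integral_indic//.
    apply: ge0_le_integral => //.
    + exact: mind.
    + move=> x _; rewrite lee_fin indicE.
      by case: (boolP (x \in K)) => [/set_mem/fK ->//|_]; have /andP[] := f01 x.
  have hi n : (\int[mun n]_(x in [set: borel_rV R d]) (f x)%:E <= mun n G)%E.
    rewrite -[X in _ (mun n) X]setIT -integral_indic//.
    apply: ge0_le_integral => //.
    + by move=> x _; rewrite lee_fin; have /andP[] := f01 x.
    + exact: mind.
    + move=> x _; rewrite lee_fin indicE; have /andP[_] := f01 x.
      by case: (boolP (x \in G)) => [//|/negP xG _]; rewrite fG// => /mem_set.
  have bf : exists M : R, forall x, `|f x| <= M.
    by exists 1 => x; have /andP[f0 f1] := f01 x; rewrite ger0_norm.
  have /(_ [set y | c%:E < y]%E)[] := w f cf bf.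
    by apply: open_nbhs_nbhs; split => //; exact: open_ereal_gt_ereal.
  by move=> N _ NP; exists N => // n /= Nn; apply: lt_le_trans (hi n); exact: NP.
- have bf : exists M : R, forall x : 'rV[R]_d, `|1 : R| <= M by exists 1; rewrite normr1.
  have I1 (m : measureRd) :
      (\int[m]_(x in [set: borel_rV R d]) 1%:E = m [set: borel_rV R d])%E.
    by rewrite integral_cst// mul1e.
  have c1 : continuous ((fun=> 1) : 'rV[R]_d -> R) by exact: cst_continuous.
  have /(_ [set y | y < c%:E]%E)[] := w _ c1 bf.
    apply: open_nbhs_nbhs; split => //; first exact: open_ereal_lt_ereal.
    by rewrite /= I1.
  by move=> N _ NP; exists N => // n /= Nn; have := NP n Nn; rewrite /= I1.
Qed.

End weak_convergence.

(** * A strong law of large numbers *)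

Section law_of_large_numbers.
Variable R : realType.

Lemma block_square (n : nat) : (0 < n)%N ->
  exists k, (k.+1 ^ 2 <= n < k.+2 ^ 2)%N.
Proof.
case: n => // n _; elim: n => [|n [k /andP[kn nk]]]; first by exists 0%N.
have [nk'|nk'] := ltnP n.+2 (k.+2 ^ 2).
  by exists k; rewrite nk' andbT (leq_trans kn).
exists k.+1; rewrite nk' /= (leq_ltn_trans nk)// ltn_exp2r//.
Qed.

(** Convergence along the squares suffices, since between two consecutive
    squares the partial sums move by at most the length of the gap, which is
    negligible against the square. *)
Lemma cvg_mean_of_squares (s : nat -> R) (p : R) : 0 <= p <= 1 ->
  (forall n, 0 <= s n.+1 - s n <= 1) ->
  ((k.+1 ^ 2)%:R^-1 * s (k.+1 ^ 2)%N @[k --> \oo] --> p) ->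
  (n%:R^-1 * s n @[n --> \oo] --> p).
Proof.
move=> /andP[p0 p1] s01 sq.
have drift n m : (n <= m)%N ->
    `|(s m - m%:R * p) - (s n - n%:R * p)| <= (m - n)%:R.
  move=> nm; rewrite -(subnKC nm) addKn; elim: (m - n)%N => [|l IH].
    by rewrite addn0 subrr normr0.
  rewrite addnS; have /andP[d0 d1] := s01 (n + l)%N.
  move: IH; rewrite !ler_norml -[in l.+1%:R]addn1 -[in (n + l).+1%:R]addn1 !natrD.
  by move=> /andP[IH1 IH2]; apply/andP; split; nra.
apply/cvgrPdist_le => e e0.
(* With N the largest square up to n, the error at N contributes (e / 2) N and
   the gap n - N <= 2 (k + 1) another 2 (e / 4) N; both are compared with n e. *)
have e20 : 0 < e / 2 by rewrite divr_gt0.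
have e40 : 0 < e / 4 by rewrite divr_gt0.
have /cvgrPdist_le/(_ _ e20)[K1 _ HK1] := sq.
have [K2 HK2] := @ltr_add_invr R 0 (e / 4) e40; rewrite add0r in HK2.
pose K := maxn K1 K2.
exists (K.+1 ^ 2)%N => // n /= Kn.
have n0 : (0 < n)%N by rewrite (leq_trans _ Kn)// expn_gt0.
have [k /andP[kn nk]] := block_square n0.
have Kk : (K <= k)%N.
  by have := leq_ltn_trans Kn nk; rewrite ltn_exp2r// ltnS ltnS.
have := HK1 k (leq_trans (leq_maxl _ _) Kk) => /=.
set N := (k.+1 ^ 2)%N; move=> gk.
have N0 : 0 < N%:R :> R by rewrite ltr0n expn_gt0.
have nR : 0 < n%:R :> R by rewrite ltr0n.
have NE : N%:R = k.+1%:R ^+ 2 :> R by rewrite /N natrX.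
have k1 : k.+1%:R^-1 < e / 4.
  apply: le_lt_trans HK2; rewrite lef_pV2 ?posrE ?ltr0n// ler_nat ltnS.
  exact: leq_trans (leq_maxr _ _) Kk.
have Nn : N%:R <= n%:R :> R by rewrite ler_nat.
have gap : (n - N)%:R <= 2 * k.+1%:R :> R.
  rewrite -natrM ler_nat leq_subLR -ltnS; apply: leq_trans nk _.
  by rewrite -[k.+2]addn1 sqrnD muln1 -/N addnAC addn1.
have gk' : `|s N - N%:R * p| <= e / 2 * N%:R.
  have -> : s N - N%:R * p = N%:R * (N%:R^-1 * s N - p).
    by rewrite mulrBr mulVKf ?gt_eqF.
  by rewrite normrM gtr0_norm// mulrC ler_pM2r// distrC.
have kN : k.+1%:R <= e / 4 * N%:R.
  rewrite NE expr2 mulrA ler_peMl// ?ler0n//.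
  by rewrite -ler_pdivrMr ?ltr0n// mul1r ltW.
have d := drift _ _ kn.
rewrite distrC -[X in _ - X](mulKf (lt0r_neq0 nR)) -mulrBr normrM.
rewrite (ger0_norm (_ : 0 <= n%:R^-1)) ?invr_ge0 ?ler0n//.
rewrite ler_pdivrMl//.
have : `|s n - n%:R * p| <= `|(s n - n%:R * p) - (s N - N%:R * p)| + `|s N - N%:R * p|.
  by apply: le_trans (ler_normD _ _); rewrite subrK.
have : e * N%:R <= n%:R * e by rewrite mulrC ler_wpM2r// ltW.
by lra.
Qed.

Section indicators.
Variables (d : measure_display) (T : measurableType d) (P : probability T R).
Variables (A : nat -> set T) (p : R).
Hypothesis mA : forall i, measurable (A i).
Hypothesis PA : forall i, P (A i) = p%:E.
Hypothesis PAA : forall i j, i != j -> P (A i `&` A j) = (p * p)%:E.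

Let S n w : R := \sum_(i < n) \1_(A i) w.

Let S_ge0 n w : 0 <= S n w. Proof. exact: sumr_ge0. Qed.

Let mS n : measurable_fun setT (S n).
Proof. by apply: measurable_sum => i; exact: measurable_indic. Qed.

Let p_ge0 : 0 <= p.
Proof. by rewrite -lee_fin -(PA 0%N). Qed.

Let int_S n : (\int[P]_w (S n w)%:E = (n%:R * p)%:E)%E.
Proof.
under eq_integral do rewrite -sumEFin.
rewrite ge0_integral_sum//; last first.
  by move=> i; apply/measurable_EFinP; exact: measurable_indic.
rewrite (eq_bigr (fun=> p%:E)) => [|i _].
  by rewrite sumEFin sumr_const card_ord -[X in X%:E = _]mulr_natl.
by rewrite integral_indic// setIT; exact: PA.
Qed.

Let int_S2 n :
  (\int[P]_w (S n w ^+ 2)%:E = (n%:R * (n%:R * (p * p) + (p - p * p)))%:E)%E.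
Proof.
have E w : (S n w ^+ 2)%:E =
    (\sum_(i < n) \sum_(j < n) (\1_(A i `&` A j) w)%:E)%E.
  rewrite expr2 /S mulr_suml -sumEFin; apply: eq_bigr => i _.
  by rewrite mulr_sumr -sumEFin; apply: eq_bigr => j _; rewrite indicI.
have mAA i j : measurable_fun setT (fun w => (\1_(A i `&` A j) w : R)%:E).
  by apply/measurable_EFinP; apply: measurable_indic; exact: measurableI.
under eq_integral do rewrite E.
rewrite ge0_integral_sum//; last 2 first.
- by move=> i; apply: emeasurable_sum => j; exact: mAA.
- by move=> i w _; apply: sume_ge0.
rewrite (eq_bigr (fun=> (n%:R * (p * p) + (p - p * p))%:E)) => [|i _].
  by rewrite sumEFin sumr_const card_ord -[X in X%:E = _]mulr_natl.
rewrite ge0_integral_sum//.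
rewrite (eq_bigr (fun j => (p * p + (i == j)%:R * (p - p * p))%:E)) => [|j _].
  rewrite sumEFin big_split/= sumr_const card_ord mulr_natl -mulr_suml.
  rewrite (bigD1 i)//= eqxx big1 ?addr0 ?mul1r// => j ji.
  by rewrite eq_sym (negPf ji).
rewrite integral_indic//; last exact: measurableI.
rewrite setIT; have [->|ij] := eqVneq i j.
  by rewrite setIid mul1r addrC subrK; exact: PA.
by rewrite mul0r addr0; exact: PAA.
Qed.

Let variance_le n : (\int[P]_w ((S n w - n%:R * p) ^+ 2)%:E <= n%:R%:E)%E.
Proof.
have p1 : p <= 1 by rewrite -lee_fin -(PA 0%N) probability_le1.
have mV : measurable_fun setT (fun w => ((S n w - n%:R * p) ^+ 2)%:E).
  by apply/measurable_EFinP/measurable_funX; apply: measurable_funB.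
have mS' : measurable_fun setT (fun w => (S n w)%:E) by exact/measurable_EFinP.
have mS2 : measurable_fun setT (fun w => (S n w ^+ 2)%:E).
  by apply/measurable_EFinP/measurable_funX.
have np0 : 0 <= n%:R * p by rewrite mulr_ge0.
(* Both sides of (S - np)^2 + 2np S = S^2 + (np)^2 are nonnegative, so the
   integral splits without any integrability condition. *)
have : (\int[P]_w (((S n w - n%:R * p) ^+ 2)%:E + (2 * (n%:R * p))%:E * (S n w)%:E)
     = \int[P]_w ((S n w ^+ 2)%:E + ((n%:R * p) ^+ 2)%:E))%E.
  by apply: eq_integral => w _; rewrite -EFinM -!EFinD; congr EFin; ring.
rewrite ge0_integralD//; last 3 first.
- by move=> w _; rewrite lee_fin sqr_ge0.
- by move=> w _; rewrite mule_ge0// lee_fin ?mulr_ge0.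
- exact: measurable_funeM.
rewrite ge0_integralD//; last 2 first.
- by move=> w _; rewrite lee_fin sqr_ge0.
- by move=> w _; rewrite lee_fin sqr_ge0.
rewrite ge0_integralZl_EFin; [|by []|by move=> w _; rewrite lee_fin|by []|
  by rewrite mulr_ge0].
have PT : (P : {measure set T -> \bar R}) [set: T] = 1%E by exact: probability_setT.
rewrite int_S int_S2 integral_cst// PT mule1.
rewrite -EFinM -EFinD; case: (\int[P]_w _)%E => [r||]//=.
rewrite -EFinD => -[rE]; rewrite lee_fin.
have : 0 <= n%:R :> R by []; nra.
Qed.

(** Strong law for indicators of pairwise independent events, by second
    moments: the squared errors along the squares have a finite sum of
    expectations, hence a finite sum almost surely. *)
Lemma strong_law_indic :
  {ae P, forall w, (n%:R^-1 * S n w) @[n --> \oo] --> p}.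
Proof.
pose N k := (k.+1 ^ 2)%N.
pose f k w : \bar R := (((N k)%:R^-1 * S (N k) w - p) ^+ 2)%:E.
have N0 k : 0 < (N k)%:R :> R by rewrite ltr0n expn_gt0.
have f0 k w : (0 <= f k w)%E by rewrite lee_fin sqr_ge0.
have mf k : measurable_fun setT (f k).
  by apply/measurable_EFinP/measurable_funX; apply: measurable_funB => //;
     apply: measurable_funM.
have int_f k : (\int[P]_w f k w <= ((N k)%:R^-1)%:E)%E.
  have E w : f k w = (((N k)%:R^-1 ^+ 2)%:E * ((S (N k) w - (N k)%:R * p) ^+ 2)%:E)%E.
    by rewrite /f -EFinM -exprMn mulrBr mulKf// gt_eqF.
  under eq_integral do rewrite E.
  rewrite ge0_integralZl_EFin; [|by []|by move=> w _; rewrite lee_fin sqr_ge0|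
    by apply/measurable_EFinP/measurable_funX; apply: measurable_funB|
    by rewrite sqr_ge0].
  apply: le_trans (lee_wpmul2l _ (variance_le _)) _.
    by rewrite lee_fin sqr_ge0.
  by rewrite -EFinM expr2 -mulrA mulVf ?mulr1// gt_eqF.
have sum_bound n : \sum_(0 <= k < n.+1) (N k)%:R^-1 <= 2 - n.+1%:R^-1 :> R.
  elim: n => [|n IH].
    by rewrite big_nat1 /N exp1n invr1; lra.
  (* Telescoping bound: b ^ 2 <= a - b for consecutive inverses a and b. *)
  rewrite big_nat_recr//=; apply: le_trans (lerD IH (lexx _)) _.
  rewrite /N natrX -exprVn; set a := n.+1%:R^-1; set b := n.+2%:R^-1.
  have b0 : 0 < b by rewrite invr_gt0 ltr0n.
  have ab : a - b = a * b.
    rewrite /a /b -(natr1 n.+1); have := ltr0Sn R n.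
    move: n.+1%:R => x x0; field.
    by rewrite !gt_eqF// addr_gt0.
  have ba : b <= a by rewrite lef_pV2 ?posrE ?ltr0n// ler_nat.
  by nra.
have int_sum : (\int[P]_w (\sum_(0 <= k <oo) f k w) < +oo)%E.
  rewrite integral_nneseries//.
  apply: (@le_lt_trans _ _ 2%:E); last by rewrite ltry.
  apply: lime_le; first by apply: is_cvg_nneseries => k _ _; exact: integral_ge0.
  exists 1%N => // -[//|n] _.
  apply: (@le_trans _ _ (\sum_(0 <= k < n.+1) ((N k)%:R^-1)%:E)%E).
    by apply: lee_sum => k _; exact: int_f.
  rewrite sumEFin lee_fin; apply: le_trans (sum_bound n) _.
  by rewrite gerBl invr_ge0.
have : P.-integrable setT (fun w => \sum_(0 <= k <oo) f k w)%E.
  apply/integrableP; split; first exact: ge0_emeasurable_sum.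
  under eq_integral do rewrite gee0_abs ?nneseries_ge0//.
  exact: int_sum.
move=> /integrable_ae => /(_ measurableT); apply: filterS => w /(_ I) fin.
apply: cvg_mean_of_squares.
- by rewrite p_ge0 -lee_fin -(PA 0%N) probability_le1.
- move=> n; rewrite /S big_ord_recr/= addrAC subrr add0r indicE.
  by case: (w \in A n); rewrite ?lexx ?ler01.
- apply/cvgrPdist_le => e e0.
  have : (\sum_(M <= k <oo) f k w)%E @[M --> \oo] --> 0%E.
    by apply: nneseries_tail_cvg => //; rewrite ltey_eq fin.
  move=> /(_ [set y | y < (e ^+ 2)%:E]%E)[].
    apply: open_nbhs_nbhs; split; first exact: open_ereal_lt_ereal.
    by rewrite /= lte_fin exprn_gt0.
  move=> K _ HK; exists K => // k /= /HK /= tail.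
  have : (f k w < (e ^+ 2)%:E)%E.
    apply: le_lt_trans tail; rewrite (nneseries_split _ 1)// addn1 big_nat1.
    by rewrite leeDl// nneseries_ge0.
  rewrite lte_fin => fe; rewrite distrC -(ler_pXn2r (n := 2))// ?nnegrE ?(ltW e0)//.
  by rewrite real_normK ?num_real// ltW.
Qed.

End indicators.

End law_of_large_numbers.

(** * Almost sure weak convergence of empirical measures *)

Section empirical_measures.
Variables (R : realType) (d : nat).
Local Notation measureRd := {measure set (borel_rV R d) -> \bar R}.

Definition atomic (n : nat) (s : nat -> 'rV[R]_d) : measureRd :=
  mscale ((n%:R : R)^-1)%:nng (msum (fun i => \d_(s i : borel_rV R d)) n).

Lemma atomicE n s (B : set 'rV[R]_d) :
  atomic n s B = (n%:R^-1 * \sum_(i < n) \1_B (s i))%:E.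
Proof.
rewrite /atomic /mscale/= /msum/= EFinM -sumEFin.
by congr (_ * _)%E.
Qed.

Lemma atomicT n s : atomic n s [set: 'rV[R]_d] = (n%:R^-1 * n%:R)%:E.
Proof.
by rewrite atomicE; under eq_bigr do rewrite indicT; rewrite sumr_const card_ord.
Qed.

Lemma atomicT_le1 n s : (atomic n s [set: 'rV[R]_d] <= 1)%E.
Proof.
rewrite atomicT lee_fin; case: n => [|n]; first by rewrite mulr0.
by rewrite mulVf// pnatr_eq0.
Qed.

Variables (d' : measure_display) (Omega : measurableType d').
Variables (P : probability Omega R) (mu : probability (borel_rV R d) R).
Variable X : nat -> {RV P >-> borel_rV R d}.
Hypothesis iidX : iid_sample mu X.

Lemma iid_frequency_cvg (B : set 'rV[R]_d) :
  measurable (B : set (borel_rV R d)) ->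
  {ae P, forall w, n%:R^-1 * (\sum_(i < n) \1_B (X i w) : R) @[n --> \oo] -->
     fine (mu B)}.
Proof.
move=> mB; case: iidX => indep same.
have mX i : measurable (X i @^-1` B).
  by rewrite -[X in measurable X]setTI; exact: measurable_funP.
have muB : (fine (mu B))%:E = mu B by rewrite fineK// fin_num_measure.
have PX i : P (X i @^-1` B) = (fine (mu B))%:E by rewrite muB -(same i).
apply: (strong_law_indic mX PX) => i j ij.
have := indep [:: i; j] (fun=> B); rewrite /= inE ij => /(_ isT (fun=> mB)).
rewrite !big_cons big_nil mule1 !PX -EFinM => <-; congr (P _).
apply/seteqP; split=> w /=.
  by move=> [wi wj] k /=; rewrite !inE => /orP[] /eqP ->.
by move=> h; split; apply: h; rewrite /= !inE eqxx ?orbT.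
Qed.

(** The null sets of the countably many finite unions of rational balls are
    discarded together; outside them [open_inner_approx] extends the lower bound
    from these unions to all open sets. *)
Lemma empirical_portmanteau_cvg :
  {ae P, forall w,
    portmanteau_cvg \oo (fun n => empirical_measure X n w) mu}.
Proof.
pose Q (o : option (seq ('rV[rat]_d * nat))) w := if o is Some s then
  n%:R^-1 * (\sum_(i < n) \1_(rballs s) (X i w) : R) @[n --> \oo] -->
  fine (mu (rballs s)) else True.
have Qae o : {ae P, forall w, Q o w}.
  case: o => [s|]; last exact: (aeW P (fun=> I)).
  exact: (iid_frequency_cvg (open_measurable_rV (@rballs_open R d s))).
have freq : {ae P, forall w, forall k, Q (unpickle k) w}.
  exact: (@ae_foralln _ _ _ P (fun k w => Q (unpickle k) w) (fun k => Qae _)).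
apply: filterS freq => w freq.
have empE n : empirical_measure X n w = atomic n (fun i => X i w) by [].
split=> [G oG c cG|c]; last first.
  move=> cT; apply: nearW => n; rewrite empE.
  apply: le_lt_trans (atomicT_le1 n _) _.
  by move: cT; rewrite -[X in (X < _)%E -> _]/(mu [set: borel_rV R d]) probability_setT.
have [s [K [_ sK KG cs]]] := open_inner_approx oG cG.
have mS := open_measurable_rV (@rballs_open R d s).
have := freq (pickle s); rewrite pickleK /Q => /cvgr_gt => /(_ c).
rewrite -lte_fin fineK ?fin_num_measure// => /(_ cs).
apply: filterS => n cn; apply: (@lt_le_trans _ _ (empirical_measure X n w (rballs s))).
  by rewrite empE atomicE lte_fin.
apply: le_measure; rewrite ?inE//; first exact: open_measurable_rV.
exact: subset_trans KG.
Qed.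

End empirical_measures.

(** * Measurability of the distance between depth regions *)

Section measurability.
Variables (R : realType).

Lemma open_preimage_measurable_mx (d' : measure_display)
    (Omega : measurableType d') (m n : nat) (f : Omega -> 'M[R]_(m, n)) :
  (forall i j, measurable_fun setT (fun w => f w i j)) ->
  forall G : set 'M[R]_(m, n), open G -> measurable (f @^-1` G).
Proof.
move=> mf G oG.
have -> : f @^-1` G = \bigcup_(p in [set p | rcball R p `<=` G]) f @^-1` rball R p.
  apply/seteqP; split=> [w Gw|w [p /= pG wp]].
    by have [p [wp pG]] := rball_basis oG Gw; exists p.
  by apply: pG; exact: subset_closed_ball.
rewrite bigcup_mkcond; apply: countable_bigcupT_measurable => [|p]; first exact: countableP.
case: ifP => _ //.
have -> : f @^-1` rball R p = \bigcap_(ij in [set: 'I_m * 'I_n])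
    ((fun w => f w ij.1 ij.2) @^-1` ball (ratpt R p.1 ij.1 ij.2) p.2.+1%:R^-1).
  apply/seteqP; split=> w /=; first by move=> [_ wp] [i j] _; exact: wp.
  by move=> wp; split => [|i j]; [rewrite invr_gt0 ltr0n|exact: (wp (i, j))].
apply: fin_bigcap_measurable; first exact: finite_finset.
move=> [i j] _; rewrite -[X in measurable X]setTI; apply: mf => //.
by apply: open_measurable; exact: ball_open.
Qed.

Variable d : nat.
Local Notation measureRd := {measure set (borel_rV R d) -> \bar R}.

Lemma eq_depth (mu nu : measureRd) x : (forall A, mu A = nu A) ->
  depth x mu = depth x nu.
Proof. by move=> e; rewrite /depth; congr ereal_inf; apply: eq_imagel. Qed.

(** Only the indices below n.+1, where inord is the identity, are read by
    [atomic n.+1]. *)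
Definition rows n (Z : 'M[R]_(n.+1, d)) (i : nat) : 'rV[R]_d := row (inord i) Z.

(** An atom in an open set stays in it when the configuration moves a little. *)
Lemma atomic_rows_portmanteau_cvg n (Z0 : 'M[R]_(n.+1, d)) :
  portmanteau_cvg (nbhs Z0) (fun Z => atomic n.+1 (rows Z)) (atomic n.+1 (rows Z0)).
Proof.
split=> [G oG c cG|c cT]; last first.
  by apply: nearW => Z; move: cT; rewrite !atomicT.
have stay : \forall Z \near Z0, forall i : 'I_n.+1, G (rows Z0 i) -> G (rows Z i).
  apply: (@filter_forall _ 'I_n.+1 (fun i Z => G (rows Z0 i) -> G (rows Z i))
    _ (nbhs_filter Z0)) => i.
  have [Gi|nGi] := pselect (G (rows Z0 i)); last by apply: nearW => Z /nGi.
  have /nbhs_ballP[e /= e0 eG] : nbhs (rows Z0 i) G by exact: open_nbhs_nbhs.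
  apply/nbhs_ballP; exists e => //= Z [_ Zij] _; apply: eG; split => // j k.
  by rewrite !mxE; exact: Zij.
apply: filterS stay => Z stay; apply: lt_le_trans cG _.
rewrite !atomicE lee_fin ler_wpM2l ?invr_ge0 ?ler0n//.
apply: ler_sum => i _; rewrite !indicE ler_nat.
case: (boolP (_ \in G)) => //= /set_mem/stay; by move=> /mem_set ->.
Qed.

Definition hits (K L : set 'rV[R]_d) := K `&` L !=set0.

(** Upper semicontinuity of the depth makes the configurations whose depth
    region misses a compact set an open set. *)
Lemma closed_hits n (alpha : R) (C : set 'rV[R]_d) : compact C ->
  closed [set Z : 'M[R]_(n.+1, d) |
    hits (depth_region alpha (atomic n.+1 (rows Z))) C].
Proof.
move=> cC; rewrite -[X in closed X]setCK; apply: open_closedC.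
rewrite openE => Z0 /= miss.
have : \forall Z \near Z0, C `<=` (fun x =>
    (depth x (atomic n.+1 (rows Z)) < alpha%:E)%E).
  have /compact_near_coveringP := cC.
  move=> /(_ _ (nbhs Z0) (fun Z x => (depth x (atomic n.+1 (rows Z)) < alpha%:E)%E)).
  apply => x Cx.
  have cvgG : portmanteau_cvg (filter_prod (nbhs x) (nbhs Z0))
     ((fun Z => atomic n.+1 (rows Z)) \o snd) (atomic n.+1 (rows Z0)).
    exact: portmanteau_cvg_comp cvg_snd (atomic_rows_portmanteau_cvg Z0).
  apply: (depth_near_lt _ _ cvgG cvg_fst).
    by rewrite (le_lt_trans (atomicT_le1 _ _))// ltry.
  rewrite ltNge; apply/negP => xa; apply: miss; exists x; split => //.
apply: filterS => Z CZ [x [xa Cx]].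
by have := CZ x Cx; rewrite ltNge => /negP; exact.
Qed.

Lemma enorm_cball_compact (x : 'rV[R]_d) (r : R) :
  compact [set y | enorm (x - y) <= r].
Proof.
apply: bounded_closed_compact.
  exists (`|x| + r); split; first exact: num_real.
  move=> M xM y /= xy; apply: le_trans (ltW xM).
  have -> : y = x - (x - y) by rewrite opprB addrCA subrr addr0.
  apply: le_trans (ler_normB _ _) _; rewrite lerD2l.
  exact: le_trans (norm_le_enorm _) xy.
apply: (@closed_comp _ _ (fun y : 'rV[R]_d => enorm (x - y)) [set s : R | s <= r]).
  by move=> y _; exact: enorm_sub_continuous.
exact: closed_le.
Qed.

Lemma excess_leP (K L : set 'rV[R]_d) (r : R) : 0 <= r ->
  (excess K L <= r%:E)%E <->
  (forall x, K x -> (ereal_inf [set (enorm (x - y))%:E | y in L] <= r%:E)%E).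
Proof.
move=> r0; split=> [/ereal_supP h x Kx|h].
  by apply: h; right; exists x.
by apply/ereal_supP => _ [->|[x Kx <-]]; [rewrite lee_fin|exact: h].
Qed.

(** A distance to the region of at most r means that every larger ball meets the
    region.  Only intersections of closed sets occur, so it is harmless that
    there are uncountably many points in K. *)
Lemma closed_excess_to_region n (alpha r : R) (K : set 'rV[R]_d) : 0 <= r ->
  closed [set Z : 'M[R]_(n.+1, d) |
    (excess K (depth_region alpha (atomic n.+1 (rows Z))) <= r%:E)%E].
Proof.
move=> r0.
have -> : [set Z : 'M[R]_(n.+1, d) |
    (excess K (depth_region alpha (atomic n.+1 (rows Z))) <= r%:E)%E] =
  \bigcap_(x in K) \bigcap_(k in [set: nat]) [set Z : 'M[R]_(n.+1, d) |
    hits (depth_region alpha (atomic n.+1 (rows Z)))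
         [set y | enorm (x - y) <= r + k.+1%:R^-1]].
  apply/seteqP; split=> Z /=.
    move=> /(excess_leP _ _ r0) h x Kx k _.
    have /ereal_inf_lt[_ [y Ly <-] yr] :
        (ereal_inf [set (enorm (x - y))%:E | y in depth_region alpha (atomic n.+1 (rows Z))] <
        (r + k.+1%:R^-1)%:E)%E.
      by apply: le_lt_trans (h x Kx) _; rewrite lte_fin ltrDl invr_gt0 ltr0n.
    by exists y; split => //=; rewrite -lee_fin ltW.
  move=> h; apply/(excess_leP _ _ r0) => x Kx.
  apply/lee_addgt0Pr => e e0.
  have [k] := @ltr_add_invr R 0 e e0; rewrite add0r => ke.
  have [y [Ly /= yr]] := h x Kx k I.
  apply: (@le_trans _ _ (enorm (x - y))%:E); first by apply: ereal_inf_lbound; exists y.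
  by rewrite -EFinD lee_fin (le_trans yr)// lerD2l ltW.
apply: closed_bigI => x _; apply: closed_bigI => k _.
exact/closed_hits/enorm_cball_compact.
Qed.

(** An atomic measure of n equal masses has depths in multiples of 1/n, so only
    the levels min(b, k/n) matter in the supremum over [a, b]. *)
Lemma depth_region_atomic_level n s (alpha b : R) (x : 'rV[R]_d) : alpha <= b ->
  depth_region alpha (atomic n.+1 s) x ->
  exists k : nat, alpha <= Num.min b (k%:R / n.+1%:R) /\
    depth_region (Num.min b (k%:R / n.+1%:R)) (atomic n.+1 s) x.
Proof.
move=> ab xalpha.
have n0 : 0 < n.+1%:R :> R by rewrite ltr0n.
have ex_k : exists k : nat, alpha * n.+1%:R <= k%:R.
  by exists (Num.truncn (alpha * n.+1%:R)).+1; apply/ltW/truncnS_gt.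
case: (ex_minnP ex_k) => k ak kmin; exists k; split.
  by rewrite le_min ab ler_pdivlMr.
rewrite /depth_region/=; apply: depth_ge => u su.
have := le_trans xalpha (depth_le (atomic n.+1 s) x su).
have -> : atomic n.+1 s (halfspace x u) =
    ((\sum_(i < n.+1) (s i \in halfspace x u))%:R / n.+1%:R)%:E.
  by rewrite atomicE mulrC natr_sum.
rewrite !lee_fin ler_pdivlMr// => /kmin kj.
by rewrite ge_min ler_pM2r ?invr_gt0// ler_nat kj orbT.
Qed.

(** The sets far (r + 1 / (m + 1)) m K are compact and exhaust the points whose
    distance to K exceeds r. *)
Definition far (r : R) (m : nat) (K : set 'rV[R]_d) : set 'rV[R]_d :=
  [set x | `|x| <= m%:R /\ forall y, K y -> r <= enorm (x - y)].

Lemma far_compact r m K : compact (far r m K).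
Proof.
apply: bounded_closed_compact.
  exists m%:R; split; first exact: num_real.
  by move=> M mM x [/= xm _]; rewrite (le_trans xm)// ltW.
have -> : far r m K = (fun x : 'rV[R]_d => `|x|) @^-1` [set s : R | s <= m%:R] `&`
    \bigcap_(y in K) (fun x : 'rV[R]_d => enorm (y - x)) @^-1` [set s : R | r <= s].
  apply/seteqP; split=> x [xm xK]; split => // y Ky.
    by rewrite /= -enormN opprB; exact: xK.
  by rewrite -enormN opprB; exact: xK.
apply: closedI.
  by apply: closed_comp; [move=> x _; exact: norm_continuous|exact: closed_le].
apply: closed_bigI => y _; apply: closed_comp; last exact: closed_ge.
by move=> x _; exact: enorm_sub_continuous.
Qed.

(** This half of the distance leads to unions instead of intersections; the
    reduction to the levels min(b, k/n) and the exhaustion by [far] make them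
    countable. *)
Lemma excess_from_region n (a b r : R) (mu : measureRd) (Z : 'M[R]_(n.+1, d)) :
  0 <= r ->
  (forall alpha, a <= alpha <= b -> (excess (depth_region alpha (atomic n.+1 (rows Z)))
     (depth_region alpha mu) <= r%:E)%E) <->
  ~ exists (k m : nat), a <= Num.min b (k%:R / n.+1%:R) /\
     hits (depth_region (Num.min b (k%:R / n.+1%:R)) (atomic n.+1 (rows Z)))
       (far (r + m.+1%:R^-1) m
          (depth_region (Num.min b (k%:R / n.+1%:R)) mu)).
Proof.
move=> r0; split.
  move=> h [k [m [ak [x [xk [xm xfar]]]]]].
  have /h/(excess_leP _ _ r0)/(_ x xk) : a <= Num.min b (k%:R / n.+1%:R) <= b.
    by rewrite ak ge_min lexx.
  apply/negP; rewrite -ltNge.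
  apply: (@lt_le_trans _ _ (r + m.+1%:R^-1)%:E).
    by rewrite lte_fin ltrDl invr_gt0 ltr0n.
  by apply/ereal_infP => _ [y Ky <-]; rewrite lee_fin; exact: xfar.
move=> nex alpha /andP[aal alb]; apply/(excess_leP _ _ r0) => x xal.
rewrite leNgt; apply/negP => rx; apply: nex.
have [k [alk xk]] := depth_region_atomic_level alb xal.
set I := ereal_inf _ in rx.
have [l lI] : exists l : nat, ((r + l.+1%:R^-1)%:E <= I)%E.
  case: I rx => [s||] //=; last by exists 0%N; rewrite leey.
  rewrite lte_fin => rs; have [l] := ltr_add_invr rs.
  by move=> ls; exists l; rewrite lee_fin ltW.
exists k, (maxn l (Num.truncn `|x|).+1); split; first exact: le_trans alk.
exists x; split => //; split.
  apply: le_trans (ltW (truncnS_gt _)) _; rewrite ler_nat leq_maxr//.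
move=> y yk.
have yal : depth_region alpha mu y.
  by apply: le_trans yk; rewrite lee_fin.
rewrite -lee_fin; apply: le_trans (_ : I <= _)%E; last first.
  by apply: ereal_inf_lbound; exists y.
apply: le_trans lI; rewrite lee_fin lerD2l lef_pV2 ?posrE ?ltr0n//.
by rewrite ler_nat ltnS leq_maxl.
Qed.

Lemma sup_region_dist_leP (nu mu : measureRd) (a b : R) (r : \bar R) :
  (sup_region_dist `[a, b] nu mu <= r)%E <->
  (forall alpha, a <= alpha <= b ->
     (excess (depth_region alpha nu) (depth_region alpha mu) <= r)%E) /\
  (forall alpha, a <= alpha <= b ->
     (excess (depth_region alpha mu) (depth_region alpha nu) <= r)%E).
Proof.
split=> [/ereal_supP h|[h1 h2]].
  have h' alpha : a <= alpha <= b ->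
      (hausdorff_dist (depth_region alpha nu) (depth_region alpha mu) <= r)%E.
    by move=> ab; apply: h; exists alpha => //=; rewrite in_itv.
  by split=> alpha /h'; rewrite /hausdorff_dist ge_max => /andP[].
apply/ereal_supP => _ [alpha /= + <-]; rewrite in_itv/= => ab.
by rewrite /hausdorff_dist ge_max h1// h2.
Qed.

Lemma measurable_sup_region_dist_le (d' : measure_display)
    (Omega : measurableType d') (Y : nat -> Omega -> 'rV[R]_d) n (a b r : R)
    (mu : measureRd) : 0 <= r ->
  (forall i j, measurable_fun setT (fun w => Y i w ord0 j)) ->
  measurable [set w |
    (sup_region_dist `[a, b] (atomic n.+1 (Y^~ w)) mu <= r%:E)%E].
Proof.
move=> r0 mY.
pose Z w : 'M[R]_(n.+1, d) := \matrix_(i, j) Y i w ord0 j.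
have mZ i j : measurable_fun setT (fun w => Z w i j).
  by under eq_fun do rewrite mxE; exact: mY.
have mclosed (G : set 'M[R]_(n.+1, d)) : closed G -> measurable (Z @^-1` G).
  move=> cG; rewrite -[Z @^-1` G]setCK preimage_setC; apply: measurableC.
  by apply: open_preimage_measurable_mx => //; rewrite openC.
have region alpha w :
    depth_region alpha (atomic n.+1 (Y^~ w)) =
    depth_region alpha (atomic n.+1 (rows (Z w))).
  apply/seteqP; rewrite /depth_region; split=> x /=;
    rewrite (@eq_depth (atomic n.+1 (Y^~ w)) (atomic n.+1 (rows (Z w))))// => A;
    rewrite !atomicE; congr (_ * _)%:E; apply: eq_bigr => i _; congr (\1_A _);
    by apply/rowP => j; rewrite !mxE inord_val.
pose lev k := Num.min b (k%:R / n.+1%:R).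
have -> : [set w | (sup_region_dist `[a, b] (atomic n.+1 (Y^~ w)) mu <= r%:E)%E] =
   ~` (\bigcup_k \bigcup_m Z @^-1` [set z | a <= lev k /\
         hits (depth_region (lev k) (atomic n.+1 (rows z)))
           (far (r + m.+1%:R^-1) m (depth_region (lev k) mu))]) `&`
   Z @^-1` (\bigcap_(alpha in `[a, b]) [set z |
      (excess (depth_region alpha mu) (depth_region alpha (atomic n.+1 (rows z)))
         <= r%:E)%E]).
  apply/seteqP; split=> w /=.
    move=> /sup_region_dist_leP[h1 h2]; split.
      move=> [k _ [m _ /= hkm]].
      have : ~ exists (k m : nat), a <= Num.min b (k%:R / n.+1%:R) /\
          hits (depth_region (Num.min b (k%:R / n.+1%:R)) (atomic n.+1 (rows (Z w))))
          (far (r + m.+1%:R^-1) m (depth_region (Num.min b (k%:R / n.+1%:R)) mu)).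
        by apply/excess_from_region => // alpha /h1; rewrite region.
      by apply; exists k, m.
    by move=> alpha /=; rewrite in_itv/= -region; exact: h2.
  move=> [h1 h2]; apply/sup_region_dist_leP; split=> alpha ab; rewrite region.
    move: alpha ab; apply/excess_from_region => // -[k [m hkm]].
    by apply: h1; exists k => //; exists m.
  by apply: h2; rewrite /= in_itv.
apply: measurableI; last first.
  by apply: mclosed; apply: closed_bigI => alpha _; exact: closed_excess_to_region.
apply: measurableC; apply: bigcupT_measurable => k; apply: bigcupT_measurable => m.
have [ak|nak] := boolP (a <= lev k); last first.
  rewrite (_ : _ @^-1` _ = set0)//.
  by apply/seteqP; split=> // w [].
rewrite (_ : [set z | _ /\ _] = [set z |
    hits (depth_region (lev k) (atomic n.+1 (rows z)))
           (far (r + m.+1%:R^-1) m (depth_region (lev k) mu))]).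
  by apply: mclosed; apply: closed_hits; exact: far_compact.
by apply/seteqP; split=> z; [case|split].
Qed.

Lemma coord_measurable_rV (j : 'I_d) :
  measurable_fun [set: borel_rV R d] (fun x : 'rV[R]_d => x ord0 j).
Proof. by apply: continuous_measurable_rV => x; exact: coord_continuous. Qed.

End measurability.

(** * Consistency of the depth regions *)

Theorem corollary14 (R : realType) (d : nat) (hd : (0 < d)%N) :
  (forall mu : probability (borel_rV R d) R,
    contiguous_support mu ->
    (exists2 x : 'rV[R]_d, median_set mu x & smooth_at x mu) ->
    forall (d' : measure_display) (Omega : measurableType d')
      (P : probability Omega R) (X : nat -> {RV P >-> borel_rV R d}),
    iid_sample mu X ->
    forall a b : R, 0 < a -> a <= b -> b < max_depth mu ->
    let E := [set w : Omega |
      sup_region_dist `[a, b] (empirical_measure X n w) mu @[n --> \oo]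
        --> 0%E] in
    measurable E /\ P E = 1%E)
  /\
  (forall mu : {finite_measure set (borel_rV R d) -> \bar R},
    smooth mu -> contiguous_support mu ->
    forall a b : R, 0 < a -> a <= b -> b < max_depth mu ->
    forall mun : nat -> {finite_measure set (borel_rV R d) -> \bar R},
    weak_cvg mun mu ->
    sup_region_dist `[a, b] (mun n) mu @[n --> \oo] --> 0%E).
Proof.
split.
  move=> mu contig [x0 medx0 smx0] d' Omega P X iid a b a0 ab bmax E.
  have muT : ((mu : {measure set (borel_rV R d) -> \bar R}) [set: 'rV[R]_d] < +oo)%E.
    by rewrite -ge0_fin_numE//; exact: fin_num_measure.
  have bx0 : (b%:E < depth x0 mu)%E.
    by apply: lt_le_trans medx0; rewrite lte_fin.
  have f0 w n := sup_region_dist_ge0 (empirical_measure X n w) mu ab.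
  have mE : measurable E.
    (* The index is shifted so that samples are nonempty. *)
    have -> : E = \bigcap_k \bigcup_N \bigcap_(n in [set n | (N <= n)%N])
        [set w | (sup_region_dist `[a, b] (atomic n.+1 (fun i => X i w)) mu
                   <= (k.+1%:R^-1)%:E)%E].
      apply/seteqP; split=> w.
        move=> /(nonneg_ecvg0P eventually_filter (f0 w)) small k _.
        have [|N _ NP] := small k.+1%:R^-1; first by rewrite invr_gt0 ltr0n.
        exists N; first by [].
        move=> n Nn; have : (N <= n.+1)%N by exact: leqW.
        exact: NP.
      move=> h; apply/(nonneg_ecvg0P eventually_filter (f0 w)) => e e0.
      have [k] := @ltr_add_invr R 0 e e0; rewrite add0r => ke.
      have [N _ NP] := h k I; exists N.+1 => // -[//|n] /= Nn.
      by apply: le_trans (NP n Nn) _; rewrite lee_fin ltW.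
    apply: bigcapT_measurable => k; apply: bigcupT_measurable => N.
    apply: bigcap_measurable; first by exists N => /=.
    move=> n _; apply: (measurable_sup_region_dist_le (Y := fun i => X i)).
      by rewrite invr_ge0.
    by move=> i j; apply: measurableT_comp (coord_measurable_rV j) _.
  split => //.
  have aeE : {ae P, forall w, E w}.
    apply: filterS (empirical_portmanteau_cvg iid) => w cvgw.
    exact: sup_region_dist_cvg muT cvgw contig smx0 bx0 a0 ab.
  rewrite -[E]setCK probability_setC; last exact: measurableC.
  by rewrite (measure_negligible _ aeE) ?sube0//; exact: measurableC.
move=> mu sm contig a b a0 ab bmax mun wcvg.
have muT : ((mu : {measure set (borel_rV R d) -> \bar R}) [set: 'rV[R]_d] < +oo)%E.
  by rewrite -ge0_fin_numE//; exact: fin_num_measure.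
have [beta [x0 betax0] bbeta] :
    exists2 beta : R, depth_region beta mu !=set0 & b < beta.
  (* As b > 0, the supremum is not the default value of the empty set. *)
  apply: sup_gt (bmax); apply/set0P/eqP => S0.
  by move: bmax; rewrite /max_depth S0 sup0 ltNge (ltW (lt_le_trans a0 ab)).
apply: (sup_region_dist_cvg (x0 := x0)) muT (weak_cvg_portmanteau wcvg) contig _ _ a0 ab.
  by move=> H Hx0; apply: sm; exists x0.
by apply: lt_le_trans betax0; rewrite lte_fin.
Qed.
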